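(* Let $(G,F)$ be an ABBE graph, and for each route $R$ of $G$ let $\mathrm{h}(R)$ denote the number of routes $R'$ of $G$ lying geometrically below $R$, including $R$ itself. Then $\mathrm{h}$ is an admissible height function for the framed triangulation $\Delta_{G,F}$.
   Context: Flow graphs. A flow graph $G$ is a finite directed acyclic graph (multiple edges allowed) with vertex set $[n]$ and edge multiset $E(G)$, all edges directed from smaller to larger vertices, with unique source $1$ and unique sink $n$. A route is a directed path from $1$ to $n$; $R(G)$ is the set of routes. The flow polytope $\mathcal{F}_G\subset\mathbb{R}^{E(G)}$ (unit flows from $1$ to $n$) is the convex hull of the $0/1$ indicator vectors of the routes, which are its vertices. Framings and coherence. A framing $F$ is a choice, at every vertex $v$, of linear orders on the incoming edges $\mathrm{In}(v)$ and the outgoing edges $\mathrm{Out}(v)$; $(G,F)$ is a framed graph. For a route $P$ through $v$ let $Pv$ (resp. $vP$) be its subpath ending (resp. beginning) at $v$. Let $w\le v$ be the smallest vertex after which $Pv$ and $Qv$ coincide; if $w$ is the first vertex of $Pv$ or $Qv$, then $Pv=_{\mathscr{I}(v)}Qv$; otherwise $Pv<_{\mathscr{I}(v)}Qv$ iff the edge of $P$ entering $w$ is smaller in $\mathrm{In}(w)$ than that of $Q$. Let $w'\ge v$ be the largest vertex before which $vP$ and $vQ$ coincide; if $w'$ is the last vertex of $vP$ or $vQ$, then $vP=_{\mathscr{O}(v)}vQ$; otherwise $vP<_{\mathscr{O}(v)}vQ$ iff the edge of $P$ leaving $w'$ is smaller in $\mathrm{Out}(w')$ than that of $Q$. Routes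 $P,Q$ are incoherent at a common inner vertex $v$ ($v\neq 1,n$) if $Pv<_{\mathscr{I}(v)}Qv$ and $vQ<_{\mathscr{O}(v)}vP$ (written $P<^{\mathrm{cw}}_v Q$), or $Q<^{\mathrm{cw}}_v P$; they are coherent if incoherent at no common inner vertex. A maximal clique is an inclusion-maximal set of pairwise coherent routes. The convex hulls of (the indicator vectors of) the maximal cliques are the top-dimensional simplices of a regular unimodular triangulation $\Delta_{G,F}$ of $\mathcal{F}_G$ (Danilov–Karzanov–Koshevoy), the framed triangulation. Top and bottom. Routes $R_1,R_2$ are incoherent along exactly one path $P\subseteq R_1\cap R_2$ if they are incoherent at every vertex $v\in P$ and nowhere else. If $R_1<^{\mathrm{cw}}_v R_2$ (for $v\in P$), put $\mathrm{Top}(R_1,R_2):=R_1vR_2$ (follow $R_1$ up to $v$, then $R_2$) and $\mathrm{Bot}(R_1,R_2):=R_2vR_1$; if $R_2<^{\mathrm{cw}}_vR_1$, put $\mathrm{Top}(R_1,R_2):=R_2vR_1$ and $\mathrm{Bot}(R_1,R_2):=R_1vR_2$. ABBE graphs. Let $(G,F)$ be a framed graph drawn in the plane (edges may cross) with vertices located from left to right in increasing order, all edges oriented monotonically from left to right, and framing $F$ induced by the drawing (incoming and outgoing edges at each vertex ordered from top to bottom). A route $R'$ lies geometrically below a route $R$ if on every vertical line intersecting both routes the intersection point with $R'$ lies (weakly) below the intersection point with $R$. $(G,F)$ is an ABBE graph if for any two routes $R_1,R_2$ that are incoherent along exactly one path, $\mathrm{Bot}(R_1,R_2)$ lies geometrically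 below $\mathrm{Top}(R_1,R_2)$. Admissibility. A function $\mathrm h:R(G)\to\mathbb{R}$ is an admissible height function for $\Delta_{G,F}$ if the regular subdivision of $\mathcal{F}_G$ obtained by lifting the indicator vector of each route $R$ to height $\mathrm h(R)$ and projecting the upper faces of the convex hull of the lifted points equals $\Delta_{G,F}$. *)

(* Defs.v *)
From HB Require Import structures.
From mathcomp Require Import all_boot all_order all_algebra.
From mathcomp Require Import all_classical all_reals all_analysis.

Set Implicit Arguments.
Unset Strict Implicit.
Unset Printing Implicit Defensive.

Import Order.TTheory GRing.Theory Num.Theory.
Import numFieldNormedType.Exports.

Local Open Scope classical_set_scope.
Local Open Scope ring_scope.

(* The vertex set [n] is 'I_n.-1.+1 with [last_vertex] = n - 1, so that the
   source 1 is [ord0] and the sink n is [ord_max]. *)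
Record flow_graph := FlowGraph {
  last_vertex : nat;
  num_edges : nat;
  src : 'I_num_edges -> 'I_last_vertex.+1;
  tgt : 'I_num_edges -> 'I_last_vertex.+1;
  src_lt_tgt : forall e, (src e < tgt e)%N;
  unique_source : forall v, (forall e, tgt e != v) <-> v = ord0;
  unique_sink : forall v, (forall e, src e != v) <-> v = ord_max }.

Arguments src {f} e.
Arguments tgt {f} e.

Notation vertex G := 'I_(last_vertex G).+1.
Notation edge G := 'I_(num_edges G).

(* Because of multiple edges, a directed path is the sequence of its edges;
   the empty sequence is the trivial path at a vertex. *)
Fixpoint dipath (G : flow_graph) (u : vertex G) (p : seq (edge G))
    (v : vertex G) : bool :=
  if p is e :: p' then (src e == u) && dipath (tgt e) p' v else u == v.

Definition path_vertices (G : flow_graph) (u : vertex G) (p : seq (edge G)) :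
  seq (vertex G) := u :: [seq tgt e | e <- p].

Lemma dipath_cat (G : flow_graph) (u v : vertex G) p q :
  dipath u (p ++ q) v =
  dipath u p (last u (map tgt p)) && dipath (last u (map tgt p)) q v.
Proof.
by elim: p u => [|e p IHp] u /=; rewrite ?eqxx //= IHp andbA.
Qed.

Lemma size_dipath (G : flow_graph) (u v : vertex G) (p : seq (edge G)) :
  dipath u p v -> (size p + u <= v)%N.
Proof.
elim: p u => [|e p IHp] u /=; first by move/eqP->.
case/andP=> /eqP <- /IHp; apply: leq_trans.
by rewrite addSnnS leq_add2l src_lt_tgt.
Qed.

Lemma dipath_subpath_to (G : flow_graph) (u v w : vertex G) p :
  dipath u p w -> v \in path_vertices u p ->
  dipath u [seq e <- p | (tgt e <= v)%N] v.
Proof.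
rewrite /path_vertices; elim: p u => [|e p IHp] u /=.
  by move=> _; rewrite mem_seq1 eq_sym.
case/andP=> /eqP eu pP; rewrite inE => /predU1P[->|vP].
  have {}eu : (u < tgt e)%N by rewrite -eu src_lt_tgt.
  suff -> : [seq f <- p | (tgt f <= u)%N] = [::] by rewrite leqNgt eu /= eqxx.
  elim: p (tgt e) eu pP {IHp} => [|f p IHp] x ux //= /andP[/eqP fx pP].
  have xf : (u < tgt f)%N by rewrite (ltn_trans ux) // -fx src_lt_tgt.
  by rewrite leqNgt xf /= (IHp _ xf pP).
have le_tv : (tgt e <= v)%N.
  elim: p (tgt e) vP pP {IHp} => [|f p IHp] x /=.
    by rewrite inE => /eqP->.
  rewrite inE => /predU1P[->//|vP] /andP[/eqP fx pP].
  by rewrite (leq_trans _ (IHp _ vP pP)) // -fx ltnW // src_lt_tgt.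
by rewrite le_tv /= eu eqxx IHp.
Qed.

Lemma dipath_subpath_from (G : flow_graph) (u v w : vertex G) p :
  dipath u p w -> v \in path_vertices u p ->
  dipath v [seq e <- p | (v <= src e)%N] w.
Proof.
rewrite /path_vertices; elim: p u => [|e p IHp] u /=.
  by move=> uw; rewrite mem_seq1 => /eqP->.
case/andP=> /eqP eu pP; rewrite inE => /predU1P[->|vP].
  rewrite eu leqnn /= eu eqxx /=.
  suff /all_filterP-> : all (fun f => u <= src f)%N p by [].
  have {}eu : (u <= tgt e)%N by rewrite -eu ltnW // src_lt_tgt.
  elim: p (tgt e) eu pP {IHp} => [|f p IHp] x ux //= /andP[/eqP fx pP].
  rewrite fx ux /=; apply: IHp pP.
  by rewrite (leq_trans ux) // -fx ltnW // src_lt_tgt.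
have lt_sv : (src e < v)%N.
  apply: leq_trans (src_lt_tgt e) _.
  elim: p (tgt e) vP pP {IHp} => [|f p IHp] x /=.
    by rewrite inE => /eqP->.
  rewrite inE => /predU1P[->//|vP] /andP[/eqP fx pP].
  by rewrite (leq_trans _ (IHp _ vP pP)) // -fx ltnW // src_lt_tgt.
by rewrite leqNgt lt_sv /=; exact: IHp pP vP.
Qed.

(* By [size_dipath] the bound on the length excludes no path from the source
   to the sink; it only makes [route G] a finite type. *)
Record route (G : flow_graph) := Route {
  route_edges :> {bseq (last_vertex G) of edge G};
  routeP : dipath ord0 route_edges ord_max }.

HB.instance Definition _ (G : flow_graph) := [isSub for @route_edges G].
HB.instance Definition _ (G : flow_graph) := [Countable of route G by <:].
HB.instance Definition _ (G : flow_graph) := [Finite of route G by <:].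

Definition route_vertices (G : flow_graph) (P : route G) : seq (vertex G) :=
  path_vertices ord0 P.

Definition strict_linear_order_on (T : finType) (A : {pred T}) (r : rel T) :
    Prop :=
  [/\ {in A, irreflexive r},
      {in A & &, transitive r} &
      {in A &, forall x y, [|| x == y, r x y | r y x]}].

(* [inlt v e f]: e comes before f in In(v). Only the values of [inlt v] on In(v)
   and of [outlt v] on Out(v) matter. *)
Record framing (G : flow_graph) := Framing {
  inlt : vertex G -> rel (edge G);
  outlt : vertex G -> rel (edge G);
  inlt_order : forall v,
    strict_linear_order_on [pred e | tgt e == v] (inlt v);
  outlt_order : forall v,
    strict_linear_order_on [pred e | src e == v] (outlt v) }.

(* Edges go left to right, so the subpath of P between two of its vertices u
   and v is obtained by filtering. *)
Definition subpath_to (G : flow_graph) (P : route G) (v : vertex G) :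
  seq (edge G) := [seq e <- P | (tgt e <= v)%N].

Definition subpath_from (G : flow_graph) (P : route G) (v : vertex G) :
  seq (edge G) := [seq e <- P | (v <= src e)%N].

Definition subpath_between (G : flow_graph) (P : route G) (u v : vertex G) :
  seq (edge G) := [seq e <- P | (u <= src e)%N && (tgt e <= v)%N].

Section Coherence.
Variables (G : flow_graph) (F : framing G).
Implicit Types (P Q : route G) (u v w : vertex G).

Definition common_vertex P Q v :=
  (v \in route_vertices P) && (v \in route_vertices Q).

(* w is the smallest vertex after which Pv and Qv coincide. *)
Definition merge_vertex P Q v w :=
  let coincide u := [&& common_vertex P Q u, (u <= v)%N &
                        subpath_between P u v == subpath_between Q u v] in
  coincide w && [forall u, coincide u ==> (w <= u)%N].

(* w is the largest vertex before which vP and vQ coincide. *)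
Definition split_vertex P Q v w :=
  let coincide u := [&& common_vertex P Q u, (v <= u)%N &
                        subpath_between P v u == subpath_between Q v u] in
  coincide w && [forall u, coincide u ==> (u <= w)%N].

(* Pv < Qv for I(v). If w is the first vertex there are no e and f as below:
   this is the case Pv = Qv for I(v). Similarly for [out_lt]. *)
Definition in_lt v P Q :=
  [exists w, merge_vertex P Q v w &&
    [exists e, exists f, [&& e \in (P : seq _), f \in (Q : seq _),
       tgt e == w, tgt f == w & inlt F w e f]]].

(* vP < vQ for O(v). *)
Definition out_lt v P Q :=
  [exists w, split_vertex P Q v w &&
    [exists e, exists f, [&& e \in (P : seq _), f \in (Q : seq _),
       src e == w, src f == w & outlt F w e f]]].

Definition cw_lt v P Q := in_lt v P Q && out_lt v Q P.

Definition incoherent_at P Q v :=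
  [&& v != ord0, v != ord_max, common_vertex P Q v &
      cw_lt v P Q || cw_lt v Q P].

Definition coherent P Q := [forall v, ~~ incoherent_at P Q v].

Definition clique (C : {set route G}) :=
  [forall P in C, forall Q in C, coherent P Q].

Definition maximal_clique (C : {set route G}) := maxset clique C.

(* P and Q are incoherent along exactly one path, the one that starts at u and
   has edge sequence p. *)
Definition incoherent_along P Q u (p : seq (edge G)) : Prop :=
  [/\ exists v, dipath u p v,
      common_vertex P Q u,
      {subset p <= (P : seq _)},
      {subset p <= (Q : seq _)} &
      forall v, incoherent_at P Q v <-> v \in path_vertices u p].

Definition splice P v Q : seq (edge G) := subpath_to P v ++ subpath_from Q v.

Lemma dipath_splice P Q v :
  common_vertex P Q v -> dipath ord0 (splice P v Q) ord_max.
Proof.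
case/andP=> vP vQ.
have Pv := dipath_subpath_to (routeP P) vP.
have dl (u x : vertex G) p : dipath u p x -> last u (map tgt p) = x.
  by elim: p u => [|e p IHp] u /=; [move/eqP|case/andP=> _ /IHp].
rewrite dipath_cat (dl _ _ _ Pv) Pv.
exact: dipath_subpath_from (routeP Q) vQ.
Qed.

(* For P and Q incoherent along exactly one path, Top and Bot do not depend on
   the vertex v chosen on it. *)
Definition Top v P Q := if cw_lt v P Q then splice P v Q else splice Q v P.
Definition Bot v P Q := if cw_lt v P Q then splice Q v P else splice P v Q.

End Coherence.

(* The edge e is drawn as the graph of [curve e] over the interval
   [vx (src e), vx (tgt e)]; the values outside it are irrelevant. *)
Record drawing (R : realType) (G : flow_graph) := Drawing {
  vx : vertex G -> R;
  vy : vertex G -> R;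
  curve : edge G -> R -> R;
  vx_mono : forall u v : vertex G, (u < v)%N -> vx u < vx v;
  curve_continuous : forall e,
    {within `[vx (src e), vx (tgt e)], continuous (curve e)};
  curve_src : forall e, curve e (vx (src e)) = vy (src e);
  curve_tgt : forall e, curve e (vx (tgt e)) = vy (tgt e) }.

(* "Smaller in the framing" means "higher in the drawing, near the vertex". *)
Definition framing_induced_by (R : realType) (G : flow_graph) (F : framing G)
    (D : drawing R G) : Prop :=
  (forall v e f, tgt e = v -> tgt f = v ->
     inlt F v e f <-> \forall x \near (vx D v)^'-, curve D f x < curve D e x) /\
  (forall v e f, src e = v -> src f = v ->
     outlt F v e f <-> \forall x \near (vx D v)^'+, curve D f x < curve D e x).

Definition on_drawn_path (R : realType) (G : flow_graph) (D : drawing R G)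
    (p : seq (edge G)) (x y : R) : Prop :=
  exists2 e, e \in p &
    vx D (src e) <= x <= vx D (tgt e) /\ y = curve D e x.

Definition geometrically_below (R : realType) (G : flow_graph)
    (D : drawing R G) (p' p : seq (edge G)) : Prop :=
  forall x y' y, on_drawn_path D p' x y' -> on_drawn_path D p x y -> y' <= y.

Definition ABBE (R : realType) (G : flow_graph) (F : framing G)
    (D : drawing R G) : Prop :=
  framing_induced_by F D /\
  forall (P Q : route G) (u : vertex G) (p : seq (edge G)),
    incoherent_along F P Q u p ->
    forall v, v \in path_vertices u p ->
      geometrically_below D (Bot F v P Q) (Top F v P Q).

Definition num_routes_below (R : realType) (G : flow_graph) (D : drawing R G)
    (P : route G) : nat :=
  #|[pred P' : route G | `[< geometrically_below D P' P >]]|.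

Definition convex_hull (R : realType) (N : nat) (A : set 'rV[R]_N) :
  set 'rV[R]_N := smallest (@convex_set R 'rV[R]_N) A.

(* The face of the polytope A in direction c. The nonempty faces of A, A itself
   included, are the sets of this form. *)
Definition face (R : realType) (N : nat) (A : set 'rV[R]_N) (c : 'cV[R]_N) :
  set 'rV[R]_N :=
  [set x | A x /\ forall y, A y -> (y *m c) 0 0 <= (x *m c) 0 0].

(* A polyhedral complex is represented by the set of its nonempty cells. Upper
   faces are those with an outer normal whose last coordinate is positive. *)
Definition regular_subdivision (R : realType) (N : nat) (I : Type)
    (a : I -> 'rV[R]_N) (h : I -> R) : set (set 'rV[R]_N) :=
  let lifted : set 'rV[R]_(N + 1) :=
    convex_hull (range (fun i => row_mx (a i) (h i)%:M)) in
  [set lsubmx @` face lifted c | c in [set c | 0 < dsubmx c 0 0]].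

Definition indicator (R : realType) (G : flow_graph) (P : route G) :
  'rV[R]_(num_edges G) := \row_e (e \in (P : seq _))%:R.

(* All the nonempty faces of the convex hulls of the maximal cliques. *)
Definition framed_triangulation (R : realType) (G : flow_graph)
    (F : framing G) : set (set 'rV[R]_(num_edges G)) :=
  [set s | exists2 C : {set route G}, maximal_clique F C &
     exists c, s = face (convex_hull (@indicator R G @` [set` C])) c].

Definition admissible_height (R : realType) (G : flow_graph) (F : framing G)
    (h : route G -> R) : Prop :=
  regular_subdivision (@indicator R G) h = @framed_triangulation R G F.

(* Main.v *)
Require Import Defs.
From mathcomp Require Import all_boot all_order all_algebra.
From mathcomp Require Import zify lra.
From mathcomp Require Import all_classical all_reals all_analysis.

(** Call [h P] the number of routes below [P]. The proof has two halves.

    Exchange. If [P] and [Q] are incoherent, there are routes [T] and [B] which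
    together use the same edges as [P] and [Q], with multiplicity, and satisfy
    [h P + h Q < h T + h B] ([ABBE_exchange]). The hypothesis on the drawing
    compares the two splices of [P] and [Q] only if the pair is incoherent along
    a single path. Replacing [Q] by [P] on one side of an incoherent vertex lowers
    the number of incoherent vertices, so by induction the hypothesis still shows,
    for every incoherent pair, that between two consecutive common vertices one
    of the routes lies above the other ([ABBE_comparable]). Taking always the upper
    piece yields a route [T] that is the pointwise maximum of [P] and [Q], and the
    lower pieces form the pointwise minimum [B]. A route below [P] or [Q] is below
    [T], a route below both is below [B], and [T] is below neither [P] nor [Q];
    counting gives the inequality ([num_routes_below_exchange]).

    Admissibility. Every height function with the exchange property is
    admissible ([exchange_admissible]). The routes on an upper face of the lifted
    polytope form a clique, since exchanging two incoherent ones would lead above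
    the face. What remains is that each maximal clique [C] spans an upper face,
    that is, that an affine function lies above [h] and touches it exactly on [C]
    ([maximal_clique_supported]). Maximize the total height over all nonnegative
    weights on routes with the same flow as the indicator of [C]. By exchange an
    optimal weight is supported on a clique, and a flow has only one such
    decomposition ([coherent_decomposition_unique]), so the indicator of [C] is
    optimal; linear programming duality then provides the affine function. Applied
    to the faces of simplices, this also identifies the lower-dimensional cells.

    Uniqueness of the coherent decomposition follows by determining, for longer
    and longer paths, how much flow passes through them: coherence says that the
    flow through a path [s] is matched monotonically between the edges entering
    and the edges leaving [s], and a monotone matching of given marginals is
    unique ([staircase_unique]). *)

Set Implicit Arguments.
Unset Strict Implicit.
Unset Printing Implicit Defensive.

Import Order.TTheory GRing.Theory Num.Theory.
Import numFieldNormedType.Exports.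

Local Open Scope classical_set_scope.
Local Open Scope ring_scope.

(** * Directed paths and routes as sets of edges *)

Section Dipaths.
Variable G : flow_graph.
Implicit Types (u v w x y z : vertex G) (e f g : edge G) (p : seq (edge G)).

Lemma dipath_le u p z : dipath u p z -> (u <= z)%N.
Proof. by move/size_dipath; lia. Qed.

Lemma dipath_split u p z e : dipath u p z -> e \in p ->
  exists p1 p2, [/\ p = p1 ++ e :: p2, dipath u p1 (src e) &
                    dipath (tgt e) p2 z].
Proof.
move=> /[swap]/splitPr[p1 p2]; rewrite dipath_cat /= => /and3P[p1P /eqP se p2P].
by exists p1, p2; split; rewrite ?se.
Qed.

Lemma dipath_edge u p z e : dipath u p z -> e \in p ->
  (u <= src e)%N /\ (tgt e <= z)%N.
Proof.
by move=> /dipath_split/[apply] -[p1 [p2 [_ /dipath_le + /dipath_le]]].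
Qed.

(** Since edges increase, two edges of one path are equal or one ends before the
    other starts. Together with its analogue for a vertex and an edge, this lets
    the rest of the proof treat routes as edge sets and replace the handling of
    sequences by comparisons of endpoints. *)
Lemma dipath_ordered u p z e f : dipath u p z -> e \in p -> f \in p ->
  [\/ e = f, (tgt e <= src f)%N | (tgt f <= src e)%N].
Proof.
move=> pP /(dipath_split pP)[p1 [p2 [-> p1P p2P]]].
rewrite mem_cat inE => /or3P[fp|/eqP->|fp].
- by apply: Or33; case: (dipath_edge p1P fp).
- exact: Or31.
- by apply: Or32; case: (dipath_edge p2P fp).
Qed.

Lemma dipath_last u p z : dipath u p z -> last u (map tgt p) = z.
Proof. by elim: p u => [|e p IHp] u /=; [move/eqP|case/andP=> _ /IHp]. Qed.

Lemma mem_tgt u p e : e \in p -> tgt e \in path_vertices u p.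
Proof. by move=> ep; rewrite inE map_f ?orbT. Qed.

Lemma mem_src u p z e : dipath u p z -> e \in p -> src e \in path_vertices u p.
Proof.
move=> pP /(dipath_split pP)[p1 [p2 [-> p1P _]]].
rewrite /path_vertices map_cat -cat_cons mem_cat -(dipath_last p1P).
by rewrite mem_last.
Qed.

Lemma mem_last_vertex u p z : dipath u p z -> z \in path_vertices u p.
Proof. by move/dipath_last<-; rewrite mem_last. Qed.

Lemma vertex_in u p v : v \in path_vertices u p ->
  v = u \/ exists2 e, e \in p & tgt e = v.
Proof.
rewrite inE => /predU1P[->|/mapP[e ep ->]]; first by left.
by right; exists e.
Qed.

Lemma vertex_out u p z v : dipath u p z -> v \in path_vertices u p ->
  v = z \/ exists2 e, e \in p & src e = v.
Proof.
elim: p u => [|e p IHp] u /=; first by rewrite mem_seq1 => /eqP-> /eqP; left.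
case/andP=> /eqP eu pP; rewrite inE => /predU1P[->|vp].
  by right; exists e; rewrite ?mem_head.
have [->|[f fp fv]] := IHp _ pP vp; first by left.
by right; exists f; rewrite // inE fp orbT.
Qed.

Lemma dipath_vertex_edge u p z v e : dipath u p z -> v \in path_vertices u p ->
  e \in p -> (tgt e <= v)%N \/ (v <= src e)%N.
Proof.
move=> pP /vertex_in[->|[f fp <-]] ep.
  by right; case: (dipath_edge pP ep).
case: (dipath_ordered pP ep fp) => [->||]; first by left.
  by move=> le; left; have := src_lt_tgt f; lia.
by right.
Qed.

(** A path jumps over every integer position between its ends; this is what
    forces an edge that fits inside a stretch of a path to belong to it. *)
Lemma dipath_cover u p z (i : nat) : dipath u p z -> (u <= i < z)%N ->
  exists2 e, e \in p & (src e <= i < tgt e)%N.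
Proof.
elim: p u => [|e p IHp] u /=; first by move=> /eqP->; lia.
case/andP=> /eqP eu pP iuz; have [ie|ei] := ltnP i (tgt e).
  by exists e; rewrite ?mem_head // ie eu; lia.
have [|f fp fi] := IHp _ pP; first by lia.
by exists f; rewrite // inE fp orbT.
Qed.

Lemma dipath_sorted u p z : dipath u p z ->
  sorted (fun e f => tgt e <= src f)%N p.
Proof.
elim: p u => [|e p IHp] u //= /andP[_ pP].
rewrite path_min_sorted ?(IHp _ pP) //; apply/allP => f fp.
by case: (dipath_edge pP fp).
Qed.

(** Paths are strictly sorted, hence determined by their sets of edges. *)
Lemma filter_dipath_eq u p z u' p' z' (a : pred (edge G)) :
  dipath u p z -> dipath u' p' z' ->
  (forall e, a e -> (e \in p) = (e \in p')) ->
    [seq e <- p | a e] = [seq e <- p' | a e].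
Proof.
move=> pP p'P eq_p.
pose r : rel (edge G) := fun e f => (tgt e <= src f)%N.
have r_tr : transitive r.
  by move=> e f g; rewrite /r => fe eg; have := src_lt_tgt e; lia.
have r_irr : irreflexive r by move=> e; rewrite /r; have := src_lt_tgt e; lia.
apply: (irr_sorted_eq r_tr r_irr); try by apply: sorted_filter => //;
  apply: dipath_sorted; eassumption.
by move=> e; rewrite !mem_filter; case ae: (a e) => //=; apply: eq_p.
Qed.

End Dipaths.

Section Routes.
Variable G : flow_graph.
Implicit Types (P Q : route G) (v w : vertex G) (e f g : edge G).

Lemma route_ordered P e f : e \in (P : seq _) -> f \in (P : seq _) ->
  [\/ e = f, (tgt e <= src f)%N | (tgt f <= src e)%N].
Proof. exact: dipath_ordered (routeP P). Qed.

Lemma route_tgt_inj P e f : e \in (P : seq _) -> f \in (P : seq _) ->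
  tgt e = tgt f -> e = f.
Proof.
move=> eP fP ef; case: (route_ordered eP fP) => //.
  by have := src_lt_tgt f; rewrite ef; lia.
by have := src_lt_tgt e; rewrite ef; lia.
Qed.

Lemma route_src_inj P e f : e \in (P : seq _) -> f \in (P : seq _) ->
  src e = src f -> e = f.
Proof.
move=> eP fP ef; case: (route_ordered eP fP) => //.
  by have := src_lt_tgt e; rewrite ef; lia.
by have := src_lt_tgt f; rewrite ef; lia.
Qed.

Lemma route_vertex_edge P v e : v \in route_vertices P -> e \in (P : seq _) ->
  (tgt e <= v)%N \/ (v <= src e)%N.
Proof. exact: dipath_vertex_edge (routeP P). Qed.

Lemma route_tgt P e : e \in (P : seq _) -> tgt e \in route_vertices P.
Proof. exact: mem_tgt. Qed.

Lemma route_src P e : e \in (P : seq _) -> src e \in route_vertices P.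
Proof. exact: mem_src (routeP P). Qed.

Lemma route_in P v : v \in route_vertices P -> v <> ord0 ->
  exists2 e, e \in (P : seq _) & tgt e = v.
Proof. by move=> /vertex_in[|]. Qed.

Lemma route_out P v : v \in route_vertices P -> v <> ord_max ->
  exists2 e, e \in (P : seq _) & src e = v.
Proof. by move=> /(vertex_out (routeP P))[|]. Qed.

Lemma route_source P : ord0 \in route_vertices P.
Proof. exact: mem_head. Qed.

Lemma route_sink P : ord_max \in route_vertices P.
Proof. exact: mem_last_vertex (routeP P). Qed.

Lemma route_cover P (i : nat) : (i < last_vertex G)%N ->
  exists2 e, e \in (P : seq _) & (src e <= i < tgt e)%N.
Proof. by move=> iG; apply: (dipath_cover (routeP P)). Qed.

Lemma route_eq P Q : (P : seq _) =i (Q : seq _) -> P = Q.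
Proof.
move=> PQ; apply/val_inj/val_inj => /=.
rewrite -[LHS]filter_predT -[RHS]filter_predT.
exact: filter_dipath_eq (routeP P) (routeP Q) _.
Qed.

(** Routes have no proper subroutes: an edge of [Q] missing from [P] would overlap
    an edge of [P], which is also one of [Q]. *)
Lemma route_sub_eq P Q : {subset (P : seq _) <= (Q : seq _)} -> P = Q.
Proof.
move=> PQ; apply: route_eq => e; apply/idP/idP => [/PQ//|eQ].
have [|f fP] := @route_cover P (src e).
  by have := src_lt_tgt e; have := ltn_ord (tgt e); lia.
move=> ef; case: (route_ordered eQ (PQ f fP)) => [->//||];
  have := src_lt_tgt e; lia.
Qed.

Lemma splice_route P v Q : common_vertex P Q v ->
  {S : route G | (S : seq _) = splice P v Q}.
Proof.
move=> /dipath_splice S.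
have sz : (size (splice P v Q) <= last_vertex G)%N.
  by have := size_dipath S; rewrite addn0.
by exists (@Route G (Bseq sz) S).
Qed.

Lemma mem_splice P v Q e : (e \in splice P v Q) =
  (e \in (P : seq _)) && (tgt e <= v)%N ||
  (e \in (Q : seq _)) && (v <= src e)%N.
Proof. by rewrite mem_cat !mem_filter andbC [in X in _ || X]andbC. Qed.

Lemma common_vertexC P Q v : common_vertex P Q v = common_vertex Q P v.
Proof. exact: andbC. Qed.

Lemma splice_common P v Q (S : route G) x : common_vertex P Q v ->
  (S : seq _) = splice P v Q ->
  (x \in route_vertices S) =
  (x \in route_vertices P) && (x <= v)%N ||
  (x \in route_vertices Q) && (v <= x)%N.
Proof.
move=> /andP[vP vQ] SE; apply/idP/idP.
  have [->|/eqP x0] := eqVneq x ord0; first by rewrite (route_source S).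
  move=> /route_in/(_ x0)[e]; rewrite SE mem_splice => + <-.
  case/orP=> /andP[eP ev]; first by rewrite (route_tgt eP) ev.
  by rewrite (route_tgt eP); have := src_lt_tgt e; lia.
have [->|/eqP x0] := eqVneq x ord0; first by rewrite (route_source S).
have [->|/eqP xn] := eqVneq x ord_max; first by rewrite (route_sink S).
case/orP=> /andP[xP xv].
  have [e eP ex] := route_in xP x0.
  by rewrite -ex route_tgt // SE mem_splice eP ex xv.
have [e eP ex] := route_out xP xn.
by rewrite -ex route_src // SE mem_splice eP ex xv orbT.
Qed.

End Routes.

(** * Incoherence as crossing along a maximal common stretch *)

Section Crossings.
Variables (G : flow_graph) (F : framing G).
Implicit Types (P Q S : route G) (u v w x y : vertex G) (e f g : edge G).

Definition agree P Q w w' := forall g,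
  (w <= src g)%N -> (tgt g <= w')%N ->
    (g \in (P : seq _)) = (g \in (Q : seq _)).

(** [w] and [w'] are the ends of a maximal stretch shared by [P] and [Q], at both
    of which the two routes use different edges, and [P] is the smaller one
    on entering and the larger one on leaving. *)
Definition cw_crossing P Q w w' := agree P Q w w' /\
  exists e f e' f',
    [/\ e \in (P : seq _), f \in (Q : seq _), tgt e = w, tgt f = w
      & inlt F w e f] /\
    [/\ e' \in (P : seq _), f' \in (Q : seq _), src e' = w', src f' = w'
      & outlt F w' f' e'].

Definition crossing P Q w w' := cw_crossing P Q w w' \/ cw_crossing Q P w w'.

Lemma agreeC P Q w w' : agree P Q w w' -> agree Q P w w'.
Proof. by move=> PQ g wg gw'; rewrite PQ. Qed.

Lemma inlt_irr v e : tgt e = v -> inlt F v e e = false.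
Proof. by move=> ev; case: (inlt_order F v) => -> //; rewrite inE ev. Qed.

Lemma outlt_irr v e : src e = v -> outlt F v e e = false.
Proof. by move=> ev; case: (outlt_order F v) => -> //; rewrite inE ev. Qed.

Lemma agree_between P Q w w' :
  agree P Q w w' -> subpath_between P w w' = subpath_between Q w w'.
Proof.
move=> PQ; apply: filter_dipath_eq (routeP P) (routeP Q) _ => e /andP[].
exact: PQ.
Qed.

(** The merge vertex need not be mentioned: a vertex [w] after which the routes
    agree and which they enter by different edges is automatically the smallest
    vertex after which they agree. *)
Lemma in_ltP v P Q : common_vertex P Q v ->
  in_lt F v P Q <-> exists w e f, [/\ (w <= v)%N, agree P Q w v &
    [/\ e \in (P : seq _), f \in (Q : seq _), tgt e = w, tgt f = w
      & inlt F w e f]].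
Proof.
move=> vPQ; split.
  case/existsP=> w /andP[/andP[/and3P[_ wv /eqP PQ] _]].
  case/existsP=> e /existsP[f /and5P[eP fQ /eqP ew /eqP fw ef]].
  exists w, e, f; split=> // g wg gv.
  have := congr1 (fun s => g \in s) PQ.
  by rewrite !mem_filter wg gv.
case=> w [e [f [wv PQ [eP fQ ew fw ef]]]].
apply/existsP; exists w; apply/andP; split; last first.
  by apply/existsP; exists e; apply/existsP; exists f;
    rewrite eP fQ ew fw ef eqxx.
apply/andP; split.
  apply/and3P; split=> //; last by rewrite (agree_between PQ).
  by apply/andP; rewrite -{1}ew -fw !route_tgt.
apply/forallP => u; apply/implyP => /and3P[/andP[uP uQ] uv /eqP PQu].
rewrite leqNgt; apply/negP => uw.
have ue : (u <= src e)%N by case: (route_vertex_edge uP eP) => //;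
  rewrite ew; lia.
have : e \in (Q : seq _).
  have : e \in subpath_between P u v by rewrite mem_filter ue ew wv.
  by rewrite PQu mem_filter => /andP[].
move/route_tgt_inj/(_ fQ); rewrite ew fw => /(_ erefl) ?; subst f.
by rewrite inlt_irr in ef.
Qed.

Lemma out_ltP v P Q : common_vertex P Q v ->
  out_lt F v P Q <-> exists w e f, [/\ (v <= w)%N, agree P Q v w &
    [/\ e \in (P : seq _), f \in (Q : seq _), src e = w, src f = w
      & outlt F w e f]].
Proof.
move=> vPQ; split.
  case/existsP=> w /andP[/andP[/and3P[_ vw /eqP PQ] _]].
  case/existsP=> e /existsP[f /and5P[eP fQ /eqP ew /eqP fw ef]].
  exists w, e, f; split=> // g vg gw.
  have := congr1 (fun s => g \in s) PQ.
  by rewrite !mem_filter vg gw.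
case=> w [e [f [vw PQ [eP fQ ew fw ef]]]].
apply/existsP; exists w; apply/andP; split; last first.
  by apply/existsP; exists e; apply/existsP; exists f;
    rewrite eP fQ ew fw ef eqxx.
apply/andP; split.
  apply/and3P; split=> //; last by rewrite (agree_between PQ).
  by apply/andP; rewrite -{1}ew -fw !route_src.
apply/forallP => u; apply/implyP => /and3P[/andP[uP uQ] uv /eqP PQu].
rewrite leqNgt; apply/negP => wu.
have eu : (tgt e <= u)%N by case: (route_vertex_edge uP eP) => //;
  rewrite ew; lia.
have : e \in (Q : seq _).
  have : e \in subpath_between P v u by rewrite mem_filter ew vw eu.
  by rewrite PQu mem_filter => /andP[].
move/route_src_inj/(_ fQ); rewrite ew fw => /(_ erefl) ?; subst f.
by rewrite outlt_irr in ef.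
Qed.

Lemma cw_ltP v P Q : common_vertex P Q v ->
  cw_lt F v P Q <-> exists w w', (w <= v <= w')%N /\ cw_crossing P Q w w'.
Proof.
move=> vPQ; have vQP : common_vertex Q P v by rewrite common_vertexC.
have /andP[vP vQ] := vPQ; split.
  case/andP=> /(in_ltP vPQ)[w [e [f [wv PQ ef]]]].
  case/(out_ltP vQP)=> w' [f' [e' [vw' QP [f'Q e'P f'w e'w ef']]]].
  exists w, w'; split; first by rewrite wv.
  split; last by exists e, f, e', f'.
  move=> g wg gw'; apply/idP/idP => [gP|gQ].
    case: (route_vertex_edge vP gP) => [gv|vg]; first by rewrite -(PQ g wg gv).
    by rewrite (QP g vg gw').
  case: (route_vertex_edge vQ gQ) => [gv|vg]; first by rewrite (PQ g wg gv).
  by rewrite -(QP g vg gw').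
case=> w [w' [/andP[wv vw'] [PQ [e [f [e' [f' [ef [e'P f'Q e'w f'w ef']]]]]]]]].
apply/andP; split.
  apply/(in_ltP vPQ); exists w, e, f; split=> // g wg gv.
  by apply: PQ => //; apply: leq_trans gv vw'.
apply/(out_ltP vQP); exists w', f', e'; split=> // g vg gw'.
by rewrite PQ // (leq_trans wv vg).
Qed.

Lemma incoherent_atP v P Q :
  incoherent_at F P Q v <-> common_vertex P Q v /\
    exists w w', (w <= v <= w')%N /\ crossing P Q w w'.
Proof.
split.
  case/and4P=> _ _ vPQ;
    have vQP : common_vertex Q P v by rewrite common_vertexC.
  by case/orP=> /cw_ltP[//|w [w' [wvw' cr]]]; split=> //; exists w, w';
    split=> //;
    [left|right].
case=> vPQ [w [w' [wvw' cr]]].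
have vQP : common_vertex Q P v by rewrite common_vertexC.
have [e [e' [ew e'w']]] : exists e e', tgt e = w /\ src e' = w'.
  by case: cr => -[_ [e [_ [e' [_ [[_ _ ? _ _] [_ _ ? _ _]]]]]]]; exists e, e'.
apply/and4P; split=> //.
- by apply/eqP => v0; have := src_lt_tgt e; move: wvw'; rewrite v0 ew /=; lia.
- apply/eqP => vn; have := src_lt_tgt e'; have := ltn_ord (tgt e').
  by move: wvw'; rewrite vn e'w' /=; lia.
apply/orP; case: cr => cr; [left|right]; apply/cw_ltP => //; by exists w, w'.
Qed.

Lemma crossing_ends P Q w w' : crossing P Q w w' ->
  exists e f e' f', [/\ e \in (P : seq _), f \in (Q : seq _),
       tgt e = w, tgt f = w
     & (e \notin (Q : seq _)) && (f \notin (P : seq _))] /\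
    [/\ e' \in (P : seq _), f' \in (Q : seq _),
       src e' = w', src f' = w'
     & (e' \notin (Q : seq _)) && (f' \notin (P : seq _))].
Proof.
move=> cr.
have [e [f [e' [f' [[eP fQ ew fw ef] [e'P f'Q e'w f'w ef']]]]]] :
    exists e f e' f', [/\ e \in (P : seq _), f \in (Q : seq _),
       tgt e = w, tgt f = w & e != f] /\
    [/\ e' \in (P : seq _), f' \in (Q : seq _),
       src e' = w', src f' = w' & e' != f'].
  case: cr => -[_ [e [f [e' [f' [[? ? ? ? ef] [? ? ? ? ef']]]]]]].
    exists e, f, e', f'; split; split=> //; apply/eqP => ee; subst.
      by rewrite inlt_irr in ef.
    by rewrite outlt_irr in ef'.
  exists f, e, f', e'; split; split=> //; apply/eqP => ee; subst.
    by rewrite inlt_irr in ef.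
  by rewrite outlt_irr in ef'.
exists e, f, e', f'; split; split=> //; apply/andP; split; apply/negP.
- by move=> eQ; case/eqP: ef; apply: (route_tgt_inj eQ fQ); rewrite ew.
- by move=> fP; case/eqP: ef; apply: (route_tgt_inj eP fP); rewrite ew.
- by move=> eQ; case/eqP: ef'; apply: (route_src_inj eQ f'Q); rewrite e'w.
- by move=> fP; case/eqP: ef'; apply: (route_src_inj e'P fP); rewrite e'w.
Qed.

(** A crossing only depends on the edges that touch its stretch. *)
Lemma crossing_transfer P Q S w w' :
  (forall g, (w <= tgt g)%N -> (src g <= w')%N ->
     (g \in (Q : seq _)) = (g \in (S : seq _))) ->
  (w <= w')%N -> crossing P Q w w' -> crossing P S w w'.
Proof.
move=> QS ww' [] [PQ [e [f [e' [f' [[eP fQ ew fw ef]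
  [e'P f'Q e'w f'w ef']]]]]]].
- left; split.
    move=> g wg gw'; rewrite PQ // QS //.
      by have := src_lt_tgt g; lia.
    by have := src_lt_tgt g; lia.
  exists e, f, e', f'; split; split=> //; rewrite -QS // ?fw ?f'w //.
    by have := src_lt_tgt f; rewrite fw; lia.
  by have := src_lt_tgt f'; rewrite f'w; lia.
right; split.
  move=> g wg gw'; rewrite -PQ // QS //.
    by have := src_lt_tgt g; lia.
  by have := src_lt_tgt g; lia.
exists e, f, e', f'; split; split=> //; rewrite -QS // ?ew ?e'w //.
  by have := src_lt_tgt e; rewrite ew; lia.
by have := src_lt_tgt e'; rewrite e'w; lia.
Qed.

(** Replacing [Q] by [P] from a common vertex [y] on keeps the crossings that end
    before [y], destroys all others and creates none, because at the end of a
    crossing the two routes must differ. *)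
Lemma crossing_splice_before P Q S y w w' : (w <= w')%N ->
  common_vertex P Q y -> (S : seq _) = splice Q y P ->
  crossing P S w w' <-> crossing P Q w w' /\ (w' < y)%N.
Proof.
move=> ww' /andP[yP yQ] SE.
have QS : (w' < y)%N -> forall g, (w <= tgt g)%N -> (src g <= w')%N ->
     (g \in (Q : seq _)) = (g \in (S : seq _)).
  move=> w'y g wg gw'; rewrite SE mem_splice.
  have -> : (y <= src g)%N = false by lia.
  rewrite andbF orbF; case gQ: (g \in _) => //=; apply/esym.
  by case: (route_vertex_edge yQ gQ) => //; lia.
split=> [cr|[cr w'y]]; last exact: crossing_transfer (QS w'y) ww' cr.
suff w'y : (w' < y)%N.
  by split=> //; apply: crossing_transfer cr => // g wg gw'; rewrite QS.
have [_ [_ [_ [f' [_ [_ f'S _ f'w /andP[_ f'P]]]]]]] := crossing_ends cr.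
move: f'S; rewrite SE mem_splice (negPf f'P) orbF => /andP[_].
by have := src_lt_tgt f'; rewrite f'w; lia.
Qed.

Lemma crossing_splice_after P Q S x w w' : (w <= w')%N ->
  common_vertex P Q x -> (S : seq _) = splice P x Q ->
  crossing P S w w' <-> crossing P Q w w' /\ (x < w)%N.
Proof.
move=> ww' /andP[xP xQ] SE.
have QS : (x < w)%N -> forall g, (w <= tgt g)%N -> (src g <= w')%N ->
     (g \in (Q : seq _)) = (g \in (S : seq _)).
  move=> xw g wg gw'; rewrite SE mem_splice.
  have -> : (tgt g <= x)%N = false by lia.
  rewrite andbF /=; case gQ: (g \in _) => //=; apply/esym.
  by case: (route_vertex_edge xQ gQ) => //; lia.
split=> [cr|[cr xw]]; last exact: crossing_transfer (QS xw) ww' cr.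
suff xw : (x < w)%N.
  by split=> //; apply: crossing_transfer cr => // g wg gw'; rewrite QS.
have [_ [f [_ [_ [[_ fS _ fw /andP[_ fP]] _]]]]] := crossing_ends cr.
move: fS; rewrite SE mem_splice (negPf fP) /= => /andP[_].
by have := src_lt_tgt f; rewrite fw; lia.
Qed.

Lemma incoherent_splice_before P Q S y v :
  common_vertex P Q y -> (S : seq _) = splice Q y P ->
  incoherent_at F P S v -> incoherent_at F P Q v /\ (v < y)%N.
Proof.
move=> yPQ SE /incoherent_atP[/andP[vP vS] [w [w' [wvw']]]].
case/(crossing_splice_before _ yPQ SE); first by lia.
move=> cr w'y; have vy : (v < y)%N by lia.
split=> //; apply/incoherent_atP; split; last by exists w, w'.
rewrite /common_vertex vP; move: vS; rewrite (splice_common _ _ SE).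
  by rewrite [(y <= v)%N]leqNgt vy andbF orbF => /andP[].
by rewrite common_vertexC.
Qed.

Lemma incoherent_splice_after P Q S x v :
  common_vertex P Q x -> (S : seq _) = splice P x Q ->
  incoherent_at F P S v -> incoherent_at F P Q v /\ (x < v)%N.
Proof.
move=> xPQ SE /incoherent_atP[/andP[vP vS] [w [w' [wvw']]]].
case/(crossing_splice_after _ xPQ SE); first by lia.
move=> cr xw; have xv : (x < v)%N by lia.
split=> //; apply/incoherent_atP; split; last by exists w, w'.
rewrite /common_vertex vP; move: vS; rewrite (splice_common _ xPQ SE).
by rewrite [(v <= x)%N]leqNgt xv andbF /= => /andP[].
Qed.

Lemma crossing_incoherent_along P Q v w w' : common_vertex P Q v ->
  (w <= v <= w')%N -> crossing P Q w w' ->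
  (forall x, incoherent_at F P Q x -> (w <= x <= w')%N) ->
  incoherent_along F P Q w (subpath_between P w w').
Proof.
move=> vPQ wvw' cr only.
have [e [f [e' [f' [[eP fQ ew fw _] [e'P f'Q e'w f'w _]]]]]] :=
  crossing_ends cr.
have agr : agree P Q w w' by case: cr => -[] // /agreeC.
have wP : w \in route_vertices P by rewrite -ew route_tgt.
have wQ : w \in route_vertices Q by rewrite -fw route_tgt.
have w'P : w' \in route_vertices P by rewrite -e'w route_src.
have verts x : x \in path_vertices w (subpath_between P w w') <->
    x \in route_vertices P /\ (w <= x <= w')%N.
  split.
    move/vertex_in => [->|[g + <-]]; first by split=> //; lia.
    rewrite mem_filter => /andP[/andP[wg gw'] gP]; split;
      first exact: route_tgt.
    by have := src_lt_tgt g; lia.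
  case=> xP wxw'; have [->|/eqP xw] := eqVneq x w; first exact: mem_head.
  have [|g gP gx] := route_in xP.
    move=> x0; apply: xw; apply/val_inj; rewrite x0 /=.
    by move: wxw'; rewrite x0 /=; lia.
  rewrite -gx mem_tgt // mem_filter gP gx; case/andP: wxw' => wx ->.
  rewrite !andbT; case: (route_vertex_edge wP gP) => //; rewrite gx => xw'.
  by case: xw; apply/val_inj => /=; lia.
split.
- exists w'; rewrite /subpath_between.
  have -> : [seq g <- P | (w <= src g)%N && (tgt g <= w')%N] =
      [seq g <- [seq g <- P | (w <= src g)%N] | (tgt g <= w')%N].
    by rewrite -filter_predI; apply: eq_filter => g /=; rewrite andbC.
  apply: dipath_subpath_to (dipath_subpath_from (routeP P) wP) _.
  have [-> | /eqP nww'] := eqVneq w' w; first exact: mem_head.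
  have [|g gP gw'] := route_in w'P.
    by move=> w'0; apply: nww'; apply/val_inj => /=; move: wvw';
      rewrite w'0 /=; lia.
  rewrite -gw' mem_tgt // mem_filter gP andbT.
  case: (route_vertex_edge wP gP) => //; rewrite gw' => w'w.
  by case: nww'; apply/val_inj => /=; lia.
- by apply/andP.
- by move=> g; rewrite mem_filter => /andP[].
- by rewrite (agree_between agr) => g; rewrite mem_filter => /andP[].
move=> x; split=> [ix|/verts[xP wxw']].
  by apply/verts; split; [case/incoherent_atP: ix => /andP[]|exact: only].
apply/incoherent_atP; split; last by exists w, w'.
rewrite /common_vertex xP; have [->//|/eqP xw] := eqVneq x w.
have : x \in path_vertices w (subpath_between P w w') by apply/verts.
move=> /vertex_in[//|[g + <-]]; rewrite (agree_between agr) mem_filter.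
by case/andP=> _ /route_tgt.
Qed.

(** If the vertices of one crossing do not exhaust the incoherence, then there are
    two crossings which can be told apart by cutting at an incoherent vertex of
    the other one. *)
Lemma incoherent_separated P Q v w w' v1 : common_vertex P Q v ->
  (w <= v <= w')%N -> crossing P Q w w' ->
  incoherent_at F P Q v1 -> ~~ (w <= v1 <= w')%N ->
  exists x y wx wx' wy wy' : vertex G,
  [/\ common_vertex P Q x, common_vertex P Q y,
     (wx <= x <= wx')%N, (wy <= y <= wy')%N & [/\ crossing P Q wx wx',
       crossing P Q wy wy', (x < wy)%N & (wx' < y)%N]].
Proof.
move=> vPQ wvw' cr /incoherent_atP[v1PQ [w1 [w1' [wvw1 cr1]]]] out.
have [e [f [e' [f' [[eP fQ ew fw /andP[eQ _]]
  [e'P f'Q e'w f'w /andP[e'Q _]]]]]]] :=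
  crossing_ends cr.
have agr : agree P Q w1 w1' by case: cr1 => -[] // /agreeC.
have v1P : v1 \in route_vertices P by case/andP: v1PQ.
have [v1w|wv1] := ltnP v1 w.
  exists v1, v, w1, w1', w, w'; do 2 split=> //.
  rewrite ltnNge; apply/negP => vw1.
  move/negP: eQ; apply; rewrite -agr // ?ew; last by lia.
  by case: (route_vertex_edge v1P eP); rewrite ?ew; lia.
exists v, v1, w, w', w1, w1'; do 2 split=> //; last by lia.
rewrite ltnNge; apply/negP => vw1.
move/negP: e'Q; apply; rewrite -agr // ?e'w; first by lia.
by case: (route_vertex_edge v1P e'P); rewrite ?e'w; lia.
Qed.

End Crossings.

(** * Routes as curves and the exchange of incoherent routes *)

Section Drawings.
Variables (R : realType) (G : flow_graph) (D : drawing R G).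
Implicit Types (P Q S T B : route G) (u v w : vertex G) (e f g : edge G).
Implicit Types (x y : R).

Lemma vx_le u v : (u <= v)%N -> vx D u <= vx D v.
Proof.
rewrite leq_eqVlt => /orP[/eqP uv|/(vx_mono D)/ltW//].
by rewrite (val_inj uv).
Qed.

Lemma le_vx u v : vx D u <= vx D v -> (u <= v)%N.
Proof. by rewrite !leNgt leqNgt; apply: contra => /(vx_mono D). Qed.

Lemma drawn_range P x y : on_drawn_path D P x y ->
  vx D ord0 <= x <= vx D ord_max.
Proof.
case=> e eP [/andP[ex xe] _]; have [e0 en] := dipath_edge (routeP P) eP.
by rewrite (le_trans (vx_le e0) ex) (le_trans xe (vx_le en)).
Qed.

Lemma drawn_uniq P x y y' :
  on_drawn_path D P x y -> on_drawn_path D P x y' -> y = y'.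
Proof.
have main e f : (tgt e <= src f)%N -> vx D (src e) <= x <= vx D (tgt e) ->
    vx D (src f) <= x <= vx D (tgt f) -> curve D e x = curve D f x.
  move=> ef /andP[_ xe] /andP[fx _].
  have ee : tgt e = src f.
    by apply/val_inj/eqP; rewrite eqn_leq ef (le_vx (le_trans fx xe)).
  have -> : x = vx D (tgt e) by apply/eqP; rewrite eq_le xe ee fx.
  by rewrite curve_tgt ee curve_src.
case=> e eP [xe ->] [f fP [xf ->]].
case: (route_ordered eP fP) => [->//|/main|/main] h; first exact: h.
by rewrite h.
Qed.

Lemma drawn_vertex P v : (0 < last_vertex G)%N -> v \in route_vertices P ->
  on_drawn_path D P (vx D v) (vy D v).
Proof.
move=> n0 vP; have [v0|/eqP v0] := eqVneq v ord0.
  have [|e eP ev] := route_out vP.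
    by move/(congr1 val); rewrite v0 /=; lia.
  exists e => //; rewrite -ev curve_src lexx; split=> //.
  by rewrite ltW // vx_mono // src_lt_tgt.
have [e eP ev] := route_in vP v0.
exists e => //; rewrite -ev curve_tgt lexx andbT; split=> //.
by rewrite ltW // vx_mono // src_lt_tgt.
Qed.

Lemma drawn_dipath_total u p w x : dipath u p w -> (u < w)%N ->
  vx D u <= x <= vx D w -> exists y, on_drawn_path D p x y.
Proof.
move=> + + /andP[]; elim: p u => [|e p IHp] u.
  by move=> /eqP->; rewrite ltnn.
case/andP=> /eqP <- pP _ ex xw; have [xe|ex'] := leP x (vx D (tgt e)).
  by exists (curve D e x), e; rewrite ?mem_head // ex xe.
have tw : (tgt e < w)%N.
  rewrite ltnNge; apply/negP => /vx_le wt.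
  by move: (lt_le_trans ex' xw); rewrite ltNge wt.
have [y [f fp fx]] := IHp _ pP tw (ltW ex') xw.
by exists y, f; rewrite // inE fp orbT.
Qed.

Lemma drawn_total P x : (0 < last_vertex G)%N ->
  vx D ord0 <= x <= vx D ord_max -> exists y, on_drawn_path D P x y.
Proof. by move=> n0; apply: drawn_dipath_total (routeP P) _. Qed.

Lemma drawn_nontrivial P x y : on_drawn_path D P x y -> (0 < last_vertex G)%N.
Proof. by case=> e _ _; have := src_lt_tgt e; have := ltn_ord (tgt e); lia. Qed.

Lemma drawn_splice_before P Q S v x y : common_vertex P Q v ->
  (S : seq _) = splice P v Q -> x <= vx D v ->
  on_drawn_path D S x y <-> on_drawn_path D P x y.
Proof.
move=> vPQ SE xv; have /andP[vP vQ] := vPQ.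
have vS : v \in route_vertices S by rewrite (splice_common _ vPQ SE) vP leqnn.
split=> d; have n0 := drawn_nontrivial d; case: d => e.
  rewrite SE mem_splice => /orP[/andP[eP _] ex|/andP[eQ ve]].
    by exists e.
  case=> /andP[ex xe] ye.
  have ve' : v = src e by apply/val_inj/eqP;
    rewrite eqn_leq ve (le_vx (le_trans ex xv)).
  have -> : x = vx D v by apply/eqP; rewrite eq_le xv ve' ex.
  have -> : y = vy D v.
    by rewrite ye ve' -curve_src; congr curve; apply/eqP;
      rewrite eq_le -{1}ve' xv ex.
  exact: drawn_vertex.
move=> eP ex; case: (route_vertex_edge vP eP) => [ev|ve].
  by exists e; rewrite // SE mem_splice eP ev.
case: ex => /andP[ex xe] ye.
have ve' : v = src e by apply/val_inj/eqP;
  rewrite eqn_leq ve (le_vx (le_trans ex xv)).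
have -> : x = vx D v by apply/eqP; rewrite eq_le xv ve' ex.
have -> : y = vy D v.
  by rewrite ye ve' -curve_src; congr curve; apply/eqP;
    rewrite eq_le -{1}ve' xv ex.
exact: drawn_vertex.
Qed.

Lemma drawn_splice_after P Q S v x y : common_vertex P Q v ->
  (S : seq _) = splice P v Q -> vx D v <= x ->
  on_drawn_path D S x y <-> on_drawn_path D Q x y.
Proof.
move=> vPQ SE vx_x; have /andP[vP vQ] := vPQ.
have vS : v \in route_vertices S by rewrite (splice_common _ vPQ SE) vP leqnn.
have end_v e : (tgt e <= v)%N ->
  vx D (src e) <= x <= vx D (tgt e) /\ y = curve D e x ->
    x = vx D v /\ y = vy D v.
  move=> ev [/andP[ex xe] ye].
  have ev' : v = tgt e.
    by apply/val_inj/eqP; rewrite eqn_leq ev (le_vx (le_trans vx_x xe)).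
  have xE : x = vx D v by apply/eqP; rewrite eq_le vx_x ev' xe.
  by split=> //; rewrite ye xE ev' curve_tgt.
split=> d; have n0 := drawn_nontrivial d; case: d => e.
  rewrite SE mem_splice => /orP[/andP[eP ev]|/andP[eQ _] ex]; last by exists e.
  by case/(end_v _ ev) => -> ->; apply: drawn_vertex.
move=> eQ ex; case: (route_vertex_edge vQ eQ) => [ev|ve].
  by case/(end_v _ ev): ex => -> ->; apply: drawn_vertex.
by exists e; rewrite // SE mem_splice eQ ve orbT.
Qed.

Definition below_on u v (q p : seq (edge G)) : Prop :=
  forall x, vx D u <= x -> x <= vx D v ->
  forall y' y, on_drawn_path D q x y' -> on_drawn_path D p x y -> y' <= y.

Lemma below_on_cat u v w q p :
  below_on u v q p -> below_on v w q p -> below_on u w q p.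
Proof.
move=> uv vw x ux xw; have [xv|vx_x] := leP x (vx D v); first exact: uv.
exact: vw (ltW vx_x) xw.
Qed.

Lemma below_on_vertex P Q v : v \in route_vertices P ->
  v \in route_vertices Q ->
  below_on v v P Q.
Proof.
move=> vP vQ x vx1 vx2; have -> : x = vx D v by apply/eqP;
  rewrite eq_le vx1 vx2.
move=> y' y dP dQ; have n0 := drawn_nontrivial dP.
rewrite (drawn_uniq dP (drawn_vertex n0 vP)).
by rewrite (drawn_uniq dQ (drawn_vertex n0 vQ)).
Qed.

Lemma below_onT P Q : below_on ord0 ord_max P Q -> geometrically_below D P Q.
Proof.
move=> PQ x y' y dP dQ; have /andP[x0 xn] := drawn_range dP.
exact: PQ x0 xn _ _ dP dQ.
Qed.

(** The common vertices cut two routes into blocks of this kind, on each of which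
    the routes either share a single edge or are disjoint except for the ends. *)
Definition consecutive P Q u v := [/\ common_vertex P Q u, common_vertex P Q v,
  (u < v)%N & forall x : vertex G, common_vertex P Q x ->
    (x <= u)%N \/ (v <= x)%N].

Definition comparable_on u v P Q := below_on u v P Q \/ below_on u v Q P.

Definition same_edges P Q T B := forall e,
  ((e \in (P : seq _)) + (e \in (Q : seq _)) =
   (e \in (T : seq _)) + (e \in (B : seq _)))%N.

Lemma splice_same_edges P Q S T v : common_vertex P Q v ->
  (S : seq _) = splice P v Q -> (T : seq _) = splice Q v P ->
    same_edges P Q S T.
Proof.
move=> /andP[vP vQ] SE TE e; rewrite SE TE !mem_splice.
have h S' : v \in route_vertices S' -> e \in (S' : seq _) ->
    (v <= src e)%N = ~~ (tgt e <= v)%N.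
  by move=> vS eS; have := src_lt_tgt e; case: (route_vertex_edge vS eS); lia.
case eP: (e \in (P : seq _)); case eQ: (e \in (Q : seq _)) => //=.
- by rewrite (h _ vP eP); case: (tgt e <= v)%N.
- by rewrite (h _ vP eP) orbF; case: (tgt e <= v)%N.
- by rewrite (h _ vQ eQ) orbF; case: (tgt e <= v)%N.
Qed.

(** If one of the two routes is above the other on every block, then choosing the
    upper one on each block gives a route [T], the pointwise maximum, and the
    remaining edges form the pointwise minimum [B]. The induction moves [v] to the
    right, keeping [P] as the route that has been upper so far: when [Q] is upper
    on the next block, the tails of the two routes are swapped at [v]. *)
Lemma upper_lower_routes v P Q : common_vertex P Q v ->
  (forall u u', (v <= u)%N -> consecutive P Q u u' -> comparable_on u u' P Q) ->
  below_on ord0 v Q P ->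
  exists T B, same_edges P Q T B /\ below_on ord0 ord_max B T.
Proof.
have [k] := ubnP (last_vertex G - v); elim: k v P Q => // k IHk v P Q.
move=> kv vPQ cmp QP.
have [vn|/eqP vn] := eqVneq v ord_max; first by exists P, Q; rewrite -vn.
have v_lt : (v < last_vertex G)%N.
  by rewrite ltn_neqAle -ltnS ltn_ord andbT; apply/eqP => ?; apply: vn;
    apply/val_inj.
pose after := [pred w | common_vertex P Q w && (v < w)%N].
have : after ord_max by rewrite /= /common_vertex !route_sink v_lt.
case/(arg_minnP (fun w : vertex G => w : nat)) => v' /andP[v'PQ vv'] minv'.
have cons_vv' : consecutive P Q v v'.
  split=> // x xPQ; case: (leqP x v) => [|vx']; [by left|right].
  by apply: minv'; rewrite /= xPQ.
have kv' : (last_vertex G - v' < k)%N.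
  by have := ltn_ord v'; lia.
have [PQ|QP'] := cmp v v' (leqnn _) cons_vv'; last first.
  apply: IHk kv' v'PQ _ (below_on_cat QP QP') => u u' v'u.
  by apply: cmp; lia.
have vQP : common_vertex Q P v by rewrite common_vertexC.
have [S SE] := splice_route vPQ; have [T TE] := splice_route vQP.
have cST (z : vertex G) : (v <= z)%N ->
  common_vertex S T z = common_vertex P Q z.
  move=> vz; rewrite /common_vertex (splice_common _ vPQ SE).
  rewrite (splice_common _ vQP TE) vz !andbT.
  case: (leqP z v) => zv; last by rewrite !andbF andbC.
  have -> : z = v by apply/val_inj/eqP; rewrite eqn_leq zv vz.
  by case/andP: vPQ => -> ->.
have lo x y : x <= vx D v -> (on_drawn_path D S x y <-> on_drawn_path D P x y) *
    (on_drawn_path D T x y <-> on_drawn_path D Q x y).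
  by move=> xv; split; [exact: drawn_splice_before SE xv | exact:
    drawn_splice_before TE xv].
have hi x y : vx D v <= x -> (on_drawn_path D S x y <-> on_drawn_path D Q x y) *
    (on_drawn_path D T x y <-> on_drawn_path D P x y).
  by move=> xv; split; [exact: drawn_splice_after SE xv | exact:
    drawn_splice_after TE xv].
have [|||T' [B' [ST TB]]] := IHk v' S T kv'.
- by rewrite cST // ltnW.
- move=> u u' v'u [uST u'ST uu' noST].
  have vu : (v <= u)%N by lia.
  have [||PQu|QPu] := cmp u u' => //.
  + split; rewrite -?cST //; first by lia.
    move=> x xPQ; case: (leqP v x) => [vx'|]; last by left; lia.
    by apply: noST; rewrite cST.
  + right=> x ux xu' y' y; have vx' := le_trans (vx_le vu) ux.
    by move/(hi _ _ vx').2 => + /(hi _ _ vx').1; apply: PQu.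
  + left=> x ux xu' y' y; have vx' := le_trans (vx_le vu) ux.
    by move/(hi _ _ vx').1 => + /(hi _ _ vx').2; apply: QPu.
- apply: (@below_on_cat _ v) => x ux xu' y' y.
    by move/(lo _ _ xu').2 => + /(lo _ _ xu').1; apply: QP.
  by move/(hi _ _ ux).2 => + /(hi _ _ ux).1; apply: PQ.
exists T', B'; split=> // e; rewrite -ST.
exact: splice_same_edges SE TE e.
Qed.

(** Inclusion-exclusion: a route below [P] or below [Q] is below the maximum [T], and
    a route below both is below the minimum [B]. The inequality is strict because
    [T] itself is below [T] but below neither [P] nor [Q]. *)
Lemma num_routes_below_exchange P Q T B : same_edges P Q T B ->
  geometrically_below D B T ->
  ~ geometrically_below D P Q -> ~ geometrically_below D Q P ->
  (num_routes_below D P + num_routes_below D Q <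
   num_routes_below D T + num_routes_below D B)%N.
Proof.
move=> PQTB BT nPQ nQP.
pose below S := [set S' : route G | `[< geometrically_below D S' S >]]%SET.
have numE S : num_routes_below D S = #|below S| by rewrite cardsE.
have edgeP g S1 S2 S3 S4 : same_edges S1 S2 S3 S4 -> g \in (S1 : seq _) ->
    g \in (S3 : seq _) \/ g \in (S4 : seq _).
  move=> /(_ g) + gS; rewrite gS.
  by case: (g \in (S3 : seq _)); case: (g \in (S4 : seq _)); auto;
    case: (g \in _).
have sameC S1 S2 S3 S4 : same_edges S1 S2 S3 S4 -> same_edges S2 S1 S3 S4.
  by move=> h e; rewrite addnC h.
have sameS S1 S2 S3 S4 : same_edges S1 S2 S3 S4 -> same_edges S3 S4 S1 S2.
  by move=> h e; rewrite h.
(* At each abscissa the pair [T], [B] passes through the same two points as the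
   pair [S], [S'], and the one on [T] is the higher. *)
have upper S S' : same_edges S S' T B -> geometrically_below D S T.
  move=> same x y' y [g gS gx] dT.
  case: (edgeP _ _ _ _ _ same gS) => [gT|gB].
    by rewrite (drawn_uniq dT (y' := y')) //; exists g.
  by apply: (BT x) => //; exists g.
have sub_trans S S' : geometrically_below D S S' -> below S \subset below S'.
  move=> SS'; apply/fintype.subsetP => S1; rewrite !finset.inE => /asboolP S1S.
  apply/asboolT => x y' y d1 d'.
  have n0 := drawn_nontrivial d1.
  have [z dS] := drawn_total S n0 (drawn_range d1).
  exact: le_trans (S1S _ _ _ d1 dS) (SS' _ _ _ dS d').
have UT : below P :|: below Q \subset below T.
  rewrite finset.subUset; apply/andP; split; apply: sub_trans.
    exact: upper PQTB.
  exact: upper (sameC _ _ _ _ PQTB).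
have IB : below P :&: below Q \subset below B.
  apply/fintype.subsetP => S;
    rewrite !finset.inE => /andP[/asboolP SP /asboolP SQ].
  apply/asboolT => x y' y dS [g gB gx].
  case: (edgeP g B T P Q) => [|//|gP|gQ]; first exact/sameC/sameS.
    by apply: (SP x) => //; exists g.
  by apply: (SQ x) => //; exists g.
have T_notin S S' : same_edges S S' T B -> ~ geometrically_below D S' S ->
    T \notin below S.
  move=> same nS; rewrite finset.inE; apply/asboolPn => TS; apply: nS.
  move=> x y' y [g gS' gx] dS.
  case: (edgeP g S' S T B) => [|//|gT|gB]; first exact: sameC.
    by apply: (TS x) => //; exists g.
  have n0 := drawn_nontrivial dS.
  have [z dT] := drawn_total T n0 (drawn_range dS).
  apply: le_trans (TS _ _ _ dT dS).
  by apply: (BT x) => //; exists g.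
rewrite !numE -cardsUI -addSn leq_add //; last exact: subset_leq_card.
apply: proper_card; apply/properP; split=> //; exists T.
  by rewrite finset.inE; apply/asboolT => x y' y d d';
    rewrite (drawn_uniq d d').
rewrite finset.in_setU negb_or (T_notin _ _ PQTB) //=.
exact: (T_notin _ _ (sameC _ _ _ _ PQTB)).
Qed.

Variable F : framing G.

(** Just before the common stretch the route with the smaller incoming edge is
    strictly higher, and just after it the route with the smaller outgoing edge
    is; these are different routes. *)
Lemma cw_crossing_not_below P Q w w' : framing_induced_by F D ->
  cw_crossing F P Q w w' ->
  ~ geometrically_below D P Q /\ ~ geometrically_below D Q P.
Proof.
move=> [FI FO] [_ [e [f [e' [f' [[eP fQ ew fw ef] [e'P f'Q e'w f'w ef']]]]]]].
split=> below.
  have /(FI _ _ _ ew fw) near_w := ef.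
  have [x [fex /andP[x1 x2]]] : exists x, curve D f x < curve D e x /\
      (Num.max (vx D (src e)) (vx D (src f)) < x < vx D w).
    have lt_w : Num.max (vx D (src e)) (vx D (src f)) < vx D w.
      by rewrite gt_max -{1}ew -fw !vx_mono // src_lt_tgt.
    near (vx D w)^'- => x; exists x; split; first by near: x.
    by apply/andP; split; near: x; [exact: nbhs_left_gt | exact: nbhs_left_lt].
  move: x1; rewrite gt_max => /andP[ex fx].
  have := below x (curve D e x) (curve D f x).
  rewrite leNgt fex => h; suff : false by []; apply: h.
    by exists e => //; rewrite ew (ltW ex) (ltW x2).
  by exists f => //; rewrite fw (ltW fx) (ltW x2).
have /(FO _ _ _ f'w e'w) near_w := ef'.
have [x [fex /andP[x2 x1]]] : exists x, curve D e' x < curve D f' x /\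
    (vx D w' < x < Num.min (vx D (tgt e')) (vx D (tgt f'))).
  have lt_w : vx D w' < Num.min (vx D (tgt e')) (vx D (tgt f')).
    by rewrite lt_min -{1}e'w -f'w !vx_mono // src_lt_tgt.
  near (vx D w')^'+ => x; exists x; split; first by near: x.
  by apply/andP; split; near: x; [exact: nbhs_right_gt | exact: nbhs_right_lt].
move: x1; rewrite lt_min => /andP[ex fx].
have := below x (curve D f' x) (curve D e' x).
rewrite leNgt fex => h; suff : false by []; apply: h.
  by exists f' => //; rewrite f'w (ltW fx) (ltW x2).
by exists e' => //; rewrite e'w (ltW ex) (ltW x2).
Unshelve. all: by end_near.
Qed.

(** The hypothesis on the drawing speaks of pairs incoherent along a single path.
    For such a pair, cutting at a vertex of that path, the two splices agree with
    [P] and [Q] on each block up to order, hence every block is comparable. For any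
    other incoherent pair and a given block, cut at one of two separated incoherent
    vertices, on the side away from the block, and replace [Q] by [P] there: the
    block is unchanged, the pair is still incoherent, and it has fewer incoherent
    vertices. *)
Lemma ABBE_comparable P Q v u u' : ABBE F D -> incoherent_at F P Q v ->
  consecutive P Q u u' -> comparable_on u u' P Q.
Proof.
move=> [_ abbe].
have [k] := ubnP #|[pred z | incoherent_at F P Q z]|.
elim: k P Q v => // k IHk P Q v leqk /[dup] vinc.
case/incoherent_atP => vPQ [w [w' [wvw' cr]]] [uPQ u'PQ uu' cons].
have [only|] := pselect (forall z : vertex G, incoherent_at F P Q z ->
  (w <= z <= w')%N).
  have along := crossing_incoherent_along vPQ wvw' cr only.
  have vpath : v \in path_vertices w (subpath_between P w w').
    by case: along => _ _ _ _ <-.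
  have vQP : common_vertex Q P v by rewrite common_vertexC.
  have [S SE] := splice_route vPQ; have [T TE] := splice_route vQP.
  have cmpST : geometrically_below D S T \/ geometrically_below D T S.
    have := abbe _ _ _ _ along _ vpath; rewrite /Bot /Top SE TE.
    by case: ifP; auto.
  have [vu|u'v] := cons v vPQ.
    case: cmpST => cmpST; [right|left] => x ux xu' y' y;
      have vx' := le_trans (vx_le vu) ux => dQ dP; apply: (cmpST x).
    + by apply/(drawn_splice_after _ vPQ SE vx').
    + by apply/(drawn_splice_after _ vQP TE vx').
    + by apply/(drawn_splice_after _ vQP TE vx').
    + by apply/(drawn_splice_after _ vPQ SE vx').
  case: cmpST => cmpST; [left|right] => x ux xu' y' y;
    have xv := le_trans xu' (vx_le u'v) => dQ dP; apply: (cmpST x).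
  + by apply/(drawn_splice_before _ vPQ SE xv).
  + by apply/(drawn_splice_before _ vQP TE xv).
  + by apply/(drawn_splice_before _ vQP TE xv).
  + by apply/(drawn_splice_before _ vPQ SE xv).
move=> /existsNP[v1 /not_implyP[v1inc /negP v1out]].
have [x [y [wx [wx' [wy [wy' [xPQ yPQ wxx wyy [crx cry xwy wx'y]]]]]]]] :=
  incoherent_separated vPQ wvw' cr v1inc v1out.
have xinc : incoherent_at F P Q x by apply/incoherent_atP; split;
  last by exists wx, wx'.
have yinc : incoherent_at F P Q y by apply/incoherent_atP; split;
  last by exists wy, wy'.
have [yu|u'y] := cons y yPQ.
  have [S SE] := splice_route xPQ.
  have sub (z : vertex G) := incoherent_splice_after xPQ SE (v := z).
  have cS (z : vertex G) : (x <= z)%N ->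
    common_vertex P S z = common_vertex P Q z.
    move=> xz; rewrite /common_vertex (splice_common _ xPQ SE) xz andbT.
    by case: (z \in _) => //=; case: (leqP z x) => [zx|//]; 
       have -> : z = x by [apply/val_inj/eqP; rewrite eqn_leq zx xz];
       case/andP: xPQ => _ ->.
  have xu : (x <= u)%N by lia.
  have [|||cmp|cmp] := IHk P S y.
  - move: leqk; rewrite ltnS; apply: leq_trans; apply: proper_card;
    apply/properP; split.
      by apply/fintype.subsetP => z; rewrite !inE => /sub[].
    by exists x; rewrite !inE //; apply/negP => /sub[_]; rewrite ltnn.
  - apply/incoherent_atP; split; first by rewrite cS //; lia.
    by exists wy, wy'; split=> //;
      apply/(crossing_splice_after F _ xPQ SE) => //; lia.
  - split; rewrite ?cS //; first by lia.
    move=> z; case: (leqP x z) => [xz|]; last by left; lia.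
    by rewrite cS //; apply: cons.
  - left=> a ua au' y' y'' dP dQ; apply: (cmp a) => //.
    by apply/(drawn_splice_after _ xPQ SE) => //; apply: le_trans (vx_le xu) ua.
  - right=> a ua au' y' y'' dQ dP; apply: (cmp a) => //.
    by apply/(drawn_splice_after _ xPQ SE) => //; apply: le_trans (vx_le xu) ua.
have yQP : common_vertex Q P y by rewrite common_vertexC.
have [S SE] := splice_route yQP.
have sub (z : vertex G) := incoherent_splice_before yPQ SE (v := z).
have cS (z : vertex G) : (z <= y)%N ->
  common_vertex P S z = common_vertex P Q z.
  move=> zy; rewrite /common_vertex (splice_common _ yQP SE) zy andbT.
  case: (z \in _) => //=; case: (leqP y z) => [yz|]; rewrite ?orbF //.
  have -> : z = y by apply/val_inj/eqP; rewrite eqn_leq zy yz.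
  by case/andP: yPQ => _ ->.
have [|||cmp|cmp] := IHk P S x.
- move: leqk; rewrite ltnS; apply: leq_trans; apply: proper_card;
  apply/properP; split.
    by apply/fintype.subsetP => z; rewrite !inE => /sub[].
  by exists y; rewrite !inE //; apply/negP => /sub[_]; rewrite ltnn.
- apply/incoherent_atP; split; first by rewrite cS //; lia.
  by exists wx, wx'; split=> //;
    apply/(crossing_splice_before F _ yPQ SE) => //; lia.
- split; rewrite ?cS //; first by lia.
  move=> z; case: (leqP z y) => [zy|]; last by right; lia.
  by rewrite cS //; apply: cons.
- left=> a ua au' y' y'' dP dQ; apply: (cmp a) => //.
  by apply/(drawn_splice_before _ yQP SE) => //;
    apply: le_trans au' (vx_le u'y).
- right=> a ua au' y' y'' dQ dP; apply: (cmp a) => //.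
  by apply/(drawn_splice_before _ yQP SE) => //;
    apply: le_trans au' (vx_le u'y).
Qed.

Lemma ABBE_exchange P Q : ABBE F D -> ~~ coherent F P Q ->
  exists T B, same_edges P Q T B /\
    (num_routes_below D P + num_routes_below D Q <
     num_routes_below D T + num_routes_below D B)%N.
Proof.
move=> abbe /forallPn[v /negPn vinc].
have [T [B [PQTB BT]]] : exists T B,
  same_edges P Q T B /\ below_on ord0 ord_max B T.
  apply: (@upper_lower_routes ord0).
  - by apply/andP; split; apply: route_source.
  - by move=> u u' _; apply: ABBE_comparable abbe vinc.
  - by apply: below_on_vertex; apply: route_source.
exists T, B; split=> //.
case/incoherent_atP: vinc => _ [w [w' [_ cr]]].
have [nPQ nQP] : ~ geometrically_below D P Q /\ ~ geometrically_below D Q P.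
  by case: cr => /(cw_crossing_not_below abbe.1)[].
by apply: num_routes_below_exchange => //; apply: below_onT.
Qed.

End Drawings.

(** * Uniqueness of coherent decompositions *)

Section Staircase.
Variable R : realDomainType.

Lemma linear_order_min (T : finType) (A : {pred T}) (r : rel T)
    (D : {pred T}) i0 :
  strict_linear_order_on A r -> {subset D <= A} -> i0 \in D ->
  exists2 i, i \in D & forall k, k \in D -> k != i -> r i k.
Proof.
move=> [irr tr tot] DA i0D.
pose below i := #|[pred x | (x \in D) && r x i]|.
case: (arg_minnP below i0D) => i iD mini; exists i => // k kD ki.
have := tot _ _ (DA _ iD) (DA _ kD);
  rewrite eq_sym (negPf ki) /= => /orP[//|rki].
have := mini k kD; rewrite leqNgt => /negP[]; apply: proper_card.
apply/properP; split.
  apply/fintype.subsetP => x; rewrite !inE => /andP[xD rxk].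
  by rewrite xD (tr k x i) // DA.
by exists k; rewrite !inE kD //= irr // DA.
Qed.

Lemma sum0_exists_gt0 (I : finType) (f : I -> R) j :
  \sum_i f i = 0 -> f j < 0 -> exists i, 0 < f i.
Proof.
move=> s0 fj; apply/existsP; apply: contraLR fj => /existsPn f_le0.
rewrite -leNgt -s0 (bigD1 j) //= gerDl sumr_le0 // => i _.
by rewrite leNgt f_le0.
Qed.

(** A nonnegative matrix whose support is a monotone staircase is determined by its
    row and column sums (the northwest corner rule). At the first entry [(i, j)]
    where [a] and [b] differ, say with [b] smaller, the sums force [b] to be larger
    later in row [i] and later in column [j], and these two positive entries of [b]
    violate monotonicity. *)
Lemma staircase_unique (I J : finType) (A : {pred I}) (B : {pred J})
    (ri : rel I) (rj : rel J) (a b : I -> J -> R) :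
  strict_linear_order_on A ri -> strict_linear_order_on B rj ->
  (forall i j, 0 <= a i j) -> (forall i j, 0 <= b i j) ->
  (forall i j, 0 < a i j -> (i \in A) && (j \in B)) ->
  (forall i j, 0 < b i j -> (i \in A) && (j \in B)) ->
  (forall i j k l, 0 < a i j -> 0 < a k l -> ri i k -> ~~ rj l j) ->
  (forall i j k l, 0 < b i j -> 0 < b k l -> ri i k -> ~~ rj l j) ->
  (forall i, \sum_j a i j = \sum_j b i j) ->
  (forall j, \sum_i a i j = \sum_i b i j) ->
  forall i j, a i j = b i j.
Proof.
move=> riA rjB a0 b0 aAB bAB sa sb row col i1 j1.
have supp i j : a i j != b i j -> (i \in A) && (j \in B).
  have [/aAB//|a_le0] := ltP 0 (a i j).
  have [/bAB//|b_le0] := ltP 0 (b i j).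
  have -> : a i j = b i j; last by rewrite eqxx.
  by apply/eqP; rewrite eq_le (le_trans a_le0 (b0 _ _)) (le_trans b_le0 (a0 _
    _)).
apply/eqP; apply: contraT => ab1.
pose D := [pred i | [exists j, a i j != b i j]].
have [||i iD mini] := linear_order_min (D := D) (i0 := i1) riA.
- by move=> i /existsP[j /supp/andP[]].
- by apply/existsP; exists j1.
have [j0 ij0] := existsP iD.
pose E := [pred j | a i j != b i j].
have [||j jE minj] := linear_order_min (D := E) (i0 := j0) rjB => //.
  by move=> j /supp/andP[].
have row' : \sum_l (a i l - b i l) = 0 by rewrite sumrB row subrr.
have col' : \sum_k (a k j - b k j) = 0 by rewrite sumrB col subrr.
have rowN : \sum_l (b i l - a i l) = 0 by rewrite sumrB row subrr.
have colN : \sum_k (b k j - a k j) = 0 by rewrite sumrB col subrr.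
have step (c d : I -> J -> R) : (forall i j, 0 <= c i j) ->
  (forall i j, a i j != b i j = (d i j != c i j)) ->
    (forall i j k l, 0 < d i j -> 0 < d k l -> ri i k -> ~~ rj l j) ->
    \sum_l (d i l - c i l) = 0 -> \sum_k (d k j - c k j) = 0 ->
    d i j < c i j -> false.
  move=> c0 cd sd rowd cold dc.
  have dc' : d i j - c i j < 0 by rewrite subr_lt0.
  have [l] := sum0_exists_gt0 rowd dc'; rewrite subr_gt0 => cdl.
  have [k] := sum0_exists_gt0 cold dc'; rewrite subr_gt0 => cdk.
  have ik : ri i k.
    apply: mini.
      by apply/existsP; exists j; rewrite cd; apply/eqP => h;
        rewrite h ltxx in cdk.
    by apply/eqP => h; rewrite h ltNge (ltW dc) in cdk.
  have jl : rj j l.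
    apply: minj; first by rewrite inE cd; apply/eqP => h; rewrite h ltxx in cdl.
    by apply/eqP => h; rewrite h ltNge (ltW dc) in cdl.
  have := sd i l k j (le_lt_trans (c0 _ _) cdl) (le_lt_trans (c0 _ _) cdk) ik.
  by rewrite jl.
have : a i j != b i j by [].
rewrite neq_lt => /orP[ab|ba].
  by apply: (step b a).
by apply: (step a b) => // x y; rewrite eq_sym.
Qed.

End Staircase.

Section CliqueDecomposition.
Variables (R : realDomainType) (G : flow_graph) (F : framing G).
Implicit Types (P Q : route G) (u v w : vertex G) (e f g : edge G).
Implicit Types (lam mu : route G -> R) (p s : seq (edge G)).

(** The flow that [lam] sends through the whole of [p]; [p] is meant to be a path,
    so that containing its edges is the same as containing it as a subpath. *)
Definition path_weight lam p : R :=
  \sum_(P : route G | all [in (P : seq (edge G))] p) lam P.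

Definition coherently_supported lam :=
  forall P Q, 0 < lam P -> 0 < lam Q -> coherent F P Q.

Lemma path_weight_ge0 lam p : (forall P, 0 <= lam P) -> 0 <= path_weight lam p.
Proof. by move=> lam0; apply: sumr_ge0. Qed.

Lemma path_weight_gt0 lam p : (forall P, 0 <= lam P) -> 0 < path_weight lam p ->
  exists2 P : route G, {subset p <= (P : seq _)} & 0 < lam P.
Proof.
move=> lam0 p_gt0.
have : [exists P : route G, all [in (P : seq (edge G))] p && (0 < lam P)].
  apply: contraLR p_gt0 => /existsPn none; rewrite -leNgt sumr_le0 // => P pP.
  by move: (none P); rewrite pP /= -leNgt.
by case/existsP=> P /andP[/allP pP lamP]; exists P.
Qed.

Lemma path_weight_route lam P : path_weight lam P = lam P.
Proof.
apply: big_pred1 => Q; apply/allP/eqP => [PQ|-> //].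
by apply/esym/route_sub_eq => e /PQ.
Qed.

Lemma path_weight_rcons lam p w : w != ord_max ->
  (forall P, {subset p <= (P : seq _)} -> w \in route_vertices P) ->
  path_weight lam p = \sum_(e | src e == w) path_weight lam (rcons p e).
Proof.
move=> /eqP wn pw; rewrite /path_weight.
rewrite (exchange_big_dep (fun P : route G =>
  all [in (P : seq (edge G))] p)) /=; last first.
  by move=> e P _; rewrite all_rcons => /andP[].
apply: eq_bigr => P pP.
have [e eP ew] := route_out (pw P (allP pP)) wn.
rewrite (big_pred1 e) // => f; rewrite all_rcons pP andbT /=.
apply/andP/eqP => [[/eqP fw fP]|->]; last by rewrite ew eqxx.
by apply: (route_src_inj fP eP); rewrite fw ew.
Qed.

Lemma path_weight_cons lam p w : w != ord0 ->
  (forall P, {subset p <= (P : seq _)} -> w \in route_vertices P) ->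
  path_weight lam p = \sum_(e | tgt e == w) path_weight lam (e :: p).
Proof.
move=> /eqP w0 pw; rewrite /path_weight.
rewrite (exchange_big_dep (fun P : route G =>
  all [in (P : seq (edge G))] p)) /=; last first.
  by move=> e P _ /andP[].
apply: eq_bigr => P pP.
have [e eP ew] := route_in (pw P (allP pP)) w0.
rewrite (big_pred1 e) // => f; rewrite pP andbT /=.
apply/andP/eqP => [[/eqP fw fP]|->]; last by rewrite ew eqxx.
by apply: (route_tgt_inj fP eP); rewrite fw ew.
Qed.

Lemma mem_subdipath P u p w g : dipath u p w -> {subset p <= (P : seq _)} ->
  (u <= src g)%N -> (tgt g <= w)%N -> (g \in (P : seq _)) = (g \in p).
Proof.
move=> pP sub ug gw; apply/idP/idP => [gP|/sub//].
have lt_g := src_lt_tgt g.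
have [|h hp hg] := dipath_cover pP (i := src g); first by lia.
by case: (route_ordered gP (sub _ hp)) => [->//||]; have := src_lt_tgt h; lia.
Qed.

(** Routes through the path [s] are sorted consistently by their edges before and
    after [s], since two routes that were sorted oppositely would cross along
    [s]. *)
Lemma coherent_staircase lam w w' s i j k l : (forall P, 0 <= lam P) ->
  coherently_supported lam -> dipath w s w' ->
  tgt i = w -> tgt k = w -> src j = w' -> src l = w' ->
  0 < path_weight lam (i :: rcons s j) ->
    0 < path_weight lam (k :: rcons s l) ->
  inlt F w i k -> ~~ outlt F w' l j.
Proof.
move=> lam0 coh sP iw kw jw lw /(path_weight_gt0 lam0)[P subP lamP].
move=> /(path_weight_gt0 lam0)[Q subQ lamQ] ik; apply/negP => lj.
have sub_s t (S : route G) a b : {subset a :: rcons t b <= (S : seq _)} ->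
    [/\ a \in (S : seq _), b \in (S : seq _) & {subset t <= (S : seq _)}].
  move=> sub; split; first exact/sub/mem_head.
    by apply: sub; rewrite inE mem_rcons mem_head orbT.
  by move=> g gt; apply: sub; rewrite inE mem_rcons inE gt !orbT.
have [iP jP sP'] := sub_s _ _ _ _ subP; have [kQ lQ sQ'] := sub_s _ _ _ _ subQ.
have /forallP/(_ w)/negP := coh _ _ lamP lamQ; apply.
apply/incoherent_atP; split;
  first by rewrite /common_vertex -{1}iw -kw !route_tgt.
exists w, w'; split; first by rewrite leqnn (dipath_le sP).
left; split; last by exists i, k, j, l.
by move=> g wg gw'; rewrite (mem_subdipath sP) // (mem_subdipath sP).
Qed.

Lemma path_vertices_sub P u p w : dipath u p w -> p != [::] ->
  {subset p <= (P : seq _)} ->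
  u \in route_vertices P /\ w \in route_vertices P.
Proof.
move=> pP p0 sub.
have uP : u \in route_vertices P.
  case: p p0 pP sub => // e p _ /andP[/eqP <- _] sub.
  by apply/route_src/sub/mem_head.
split=> //; have [->//|[e ep <-]] := vertex_in (mem_last_vertex pP).
exact/route_tgt/sub.
Qed.

(** Induction on the length of [p]. A path with at least two edges is an edge
    [e0], a possibly trivial path [s] and an edge [j0]. The weights of the paths
    that extend [s] by one edge on each side form a staircase matrix, whose row and
    column sums are weights of shorter paths. *)
Lemma path_weight_unique lam mu u p w :
  (forall P, 0 <= lam P) -> (forall P, 0 <= mu P) ->
  coherently_supported lam -> coherently_supported mu ->
  path_weight lam [::] = path_weight mu [::] ->
  (forall e, path_weight lam [:: e] = path_weight mu [:: e]) ->
  dipath u p w -> path_weight lam p = path_weight mu p.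
Proof.
move=> lam0 mu0 cohl cohm tot edges.
have [k] := ubnP (size p); elim: k u p w => // k IHk u p w.
case: p => [//|e0 p]; case/lastP: p => [//|s j0] sz pP.
have {sz} sz : (size s + 1 < k)%N by move: sz; rewrite /= size_rcons; lia.
have /= /andP[/eqP e0u sjP] := pP; set v := tgt e0 in sjP.
have := sjP; rewrite -cats1 dipath_cat; set v' := last _ _ => /andP[sP] /=.
case/andP=> /eqP j0v' _.
have v0 : v != ord0 by apply/eqP => h; have := src_lt_tgt e0; rewrite -/v h.
have v'n : v' != ord_max.
  apply/eqP => h; have := src_lt_tgt j0; have := ltn_ord (tgt j0).
  by rewrite j0v' h /=; lia.
pose m (nu : route G -> R) i j := if (tgt i == v) && (src j == v')
  then path_weight nu (i :: rcons s j) else 0.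
have m_ge0 nu : (forall P, 0 <= nu P) -> forall i j, 0 <= m nu i j.
  by move=> nu0 i j; rewrite /m; case: ifP => // _; apply: path_weight_ge0.
have m_supp nu i j : 0 < m nu i j ->
    (i \in [pred e | tgt e == v]) && (j \in [pred e | src e == v']).
  by rewrite /m !inE; case: ifP => //; rewrite ltxx.
have m_stair nu : (forall P, 0 <= nu P) -> coherently_supported nu ->
    forall i j k l, 0 < m nu i j -> 0 < m nu k l -> inlt F v i k ->
      ~~ outlt F v' l j.
  move=> nu0 coh i j i' j'; rewrite /m; case: ifP; last by rewrite ltxx.
  move=> /andP[/eqP iv /eqP jv] ij; case: ifP; last by rewrite ltxx.
  move=> /andP[/eqP i'v /eqP j'v] ij'.
  exact: coherent_staircase nu0 coh sP iv i'v jv j'v ij ij'.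
have row nu i : \sum_j m nu i j =
  if tgt i == v then path_weight nu (i :: s) else 0.
  rewrite /m; case: ifP => [iv|_]; last by rewrite big1 // => j _;
    rewrite andFb.
  rewrite [RHS](path_weight_rcons _ v'n) => [|P sub];
    first by rewrite -big_mkcond.
  by case: (@path_vertices_sub P (src i) (i :: s) v');
    rewrite //= eqxx (eqP iv).
have col nu j : \sum_i m nu i j =
  if src j == v' then path_weight nu (rcons s j) else 0.
  rewrite /m; case: ifP => [jv|_]; last by rewrite big1 // => i _;
    rewrite andbF.
  rewrite [RHS](path_weight_cons _ v0) => [|P sub].
    by rewrite -big_mkcond; apply: eq_big => [i|//]; rewrite andbT.
  case: (@path_vertices_sub P v (rcons s j) (tgt j)) => //.
    by rewrite -cats1 dipath_cat -/v' sP /= jv eqxx.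
  by rewrite -size_eq0 size_rcons.
have rows i : \sum_j m lam i j = \sum_j m mu i j.
  rewrite !row; case: ifP => // /eqP iv.
  by apply: (IHk (src i) _ v'); rewrite /= ?iv ?eqxx //; lia.
have cols j : \sum_i m lam i j = \sum_i m mu i j.
  rewrite !col; case: ifP => // jv.
  apply: (IHk v _ (tgt j)); first by rewrite size_rcons; lia.
  by rewrite -cats1 dipath_cat -/v' sP /= jv eqxx.
have := staircase_unique (inlt_order F v) (outlt_order F v') (m_ge0 _ lam0)
  (m_ge0 _ mu0) (m_supp lam) (m_supp mu) (m_stair _ lam0 cohl)
  (m_stair _ mu0 cohm) rows cols e0 j0.
by rewrite /m j0v' !eqxx /= cats1.
Qed.

Theorem coherent_decomposition_unique lam mu :
  (forall P, 0 <= lam P) -> (forall P, 0 <= mu P) ->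
  coherently_supported lam -> coherently_supported mu ->
  \sum_P lam P = \sum_P mu P ->
  (forall e, \sum_(P : route G | e \in (P : seq (edge G))) lam P =
             \sum_(P : route G | e \in (P : seq (edge G))) mu P) ->
  lam =1 mu.
Proof.
move=> lam0 mu0 cohl cohm tot edges P.
rewrite -(path_weight_route lam) -(path_weight_route mu).
apply: path_weight_unique (routeP P) => // e; rewrite /path_weight /=.
rewrite -(eq_bigl _ _ (fun Q : route G => esym (andbT _))) edges.
by apply: eq_bigl => Q; rewrite andbT.
Qed.

End CliqueDecomposition.

(** * Linear programming duality *)

Lemma sum_row_mx (V : nmodType) (I : Type) (s : seq I) m n1 n2
    (a : I -> 'M[V]_(m, n1)) (b : I -> 'M[V]_(m, n2)) :
  \sum_(i <- s) row_mx (a i) (b i) =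
    row_mx (\sum_(i <- s) a i) (\sum_(i <- s) b i).
Proof.
elim: s => [|i s IHs]; first by rewrite !big_nil row_mx0.
by rewrite !big_cons IHs add_row_mx.
Qed.

Section LinearProgramming.
Variable R : realType.

(** Farkas' lemma, by Bartl's induction on the number of inequalities. If the
    inequality [k] is really needed, some [x0] satisfies the others but violates
    the conclusion; subtracting multiples of [a k] makes every functional vanish
    at [x0], which reduces to the remaining inequalities. *)
Lemma farkas (I : eqType) (N : nat) (s : seq I) (a : I -> 'rV[R]_N)
    (b : 'rV[R]_N) :
  uniq s ->
  (forall x : 'cV[R]_N, (forall i, i \in s -> (a i *m x) 0 0 <= 0) ->
     (b *m x) 0 0 <= 0) ->
  exists2 lam : I -> R, forall i, 0 <= lam i & b = \sum_(i <- s) lam i *: a i.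
Proof.
elim: s a b => [|k s IHs] a b /=.
  move=> _ b_le0; exists (fun=> 0) => //; rewrite big_nil.
  apply/eqP; rewrite -[b]trmxK trmx_eq0; apply/eqP/matrixP => j i.
  have sq := b_le0 b^T (fun i h => False_ind _ (notF h)).
  move: sq; rewrite !mxE => sq.
  have sq0 l : 0 <= b 0 l * b^T l 0 by rewrite mxE -expr2 sqr_ge0.
  have /eqP : \sum_l b 0 l * b^T l 0 = 0.
    by apply/eqP; rewrite eq_le sq sumr_ge0.
  rewrite psumr_eq0 => [/allP/(_ j)|l _]; last exact: sq0.
  by rewrite mem_index_enum !mxE ord1 mulf_eq0 orbb => /(_ isT)/eqP.
move=> /andP[ks us] b_le0.
have [imp|] := pselect (forall x : 'cV[R]_N,
    (forall i, i \in s -> (a i *m x) 0 0 <= 0) -> (b *m x) 0 0 <= 0).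
  have [lam lam0 ->] := IHs a b us imp.
  exists (fun i => if i == k then 0 else lam i) => [i|]; first by case: ifP.
  rewrite big_cons eqxx scale0r add0r; apply: eq_big_seq => i is_.
  by case: eqP => // ik; rewrite -ik is_ in ks.
move=> /existsNP[x0 /not_implyP[ax0 /negP]]; rewrite -ltNge => bx0.
have akx0 : 0 < (a k *m x0) 0 0.
  rewrite ltNge; apply/negP => akx0.
  suff : (b *m x0) 0 0 <= 0 by rewrite leNgt bx0.
  by apply: b_le0 => i; rewrite inE => /predU1P[->|/ax0].
pose t (c : 'rV[R]_N) := (c *m x0) 0 0 / (a k *m x0) 0 0.
have [|lam lam0 bE] := IHs (fun i => a i - t (a i) *: a k) (b - t b *: a k) us.
  move=> x ax.
  pose x' := x - ((a k *m x) 0 0 / (a k *m x0) 0 0) *: x0.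
  have cx' c : (c *m x') 0 0 = ((c - t c *: a k) *m x) 0 0.
    rewrite /x' /t mulmxBr mulmxBl -!scalemxAr -!scalemxAl.
    move: (c *m x) (c *m x0) (a k *m x) (a k *m x0) => A B C E; rewrite !mxE.
    by congr (_ - _); rewrite mulrAC [RHS]mulrAC [_ * B _ _]mulrC.
  rewrite -cx'; apply: b_le0 => i; rewrite inE => /predU1P[->|/ax].
    by rewrite cx' /t divff ?gt_eqF // scale1r subrr mul0mx mxE.
  by rewrite cx'.
pose mu := t b - \sum_(i <- s) lam i * t (a i).
have mu_ge0 : 0 <= mu.
  rewrite subr_ge0; apply: (@le_trans _ _ 0); last by rewrite divr_ge0 ?ltW.
  rewrite big_seq sumr_le0 // => i /ax0 aix0.
  by rewrite mulr_ge0_le0 // mulr_le0_ge0 // invr_ge0 ltW.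
exists (fun i => if i == k then mu else lam i) => [i|]; first by case: ifP.
rewrite big_cons eqxx.
have -> : \sum_(i <- s) (if i == k then mu else lam i) *: a i =
  \sum_(i <- s) lam i *: a i.
  by apply: eq_big_seq => i is_; case: eqP => // ik; rewrite -ik is_ in ks.
rewrite -[LHS](subrK (t b *: a k)) bE /mu scalerBl.
under eq_bigr do rewrite scalerBr scalerA.
by rewrite sumrB -scaler_suml [RHS]addrC [RHS]addrA [LHS]addrAC.
Qed.

Section Program.
Variables (I : finType) (N : nat) (a : I -> 'rV[R]_N) (h : I -> R).

Definition nonneg_weights (lam : I -> R) := forall i, 0 <= lam i.

(** The maximum is attained: by Farkas' lemma the set of pairs (constraint value,
    height), with heights allowed to decrease, is a closed cone, so it contains
    the supremum. The index [None] stands for decreasing the height. *)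
Lemma lp_attained (lam0 : I -> R) (M : R) : nonneg_weights lam0 ->
  (forall lam, nonneg_weights lam ->
    \sum_i lam i *: a i = \sum_i lam0 i *: a i ->
     \sum_i lam i * h i <= M) ->
  exists2 lam,
    nonneg_weights lam /\ \sum_i lam i *: a i = \sum_i lam0 i *: a i &
    forall mu, nonneg_weights mu -> \sum_i mu i *: a i = \sum_i lam0 i *: a i ->
      \sum_i mu i * h i <= \sum_i lam i * h i.
Proof.
move=> lam0_ge0 bounded; set x0 := \sum_i lam0 i *: a i in bounded *.
pose values := [set r | exists lam, [/\ nonneg_weights lam,
  \sum_i lam i *: a i = x0 & r = \sum_i lam i * h i]].
have sup_values : has_sup values.
  split; first by exists (\sum_i lam0 i * h i), lam0.
  by exists M => r [lam [lam_ge0 lamE ->]]; apply: bounded.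
have le_sup mu : nonneg_weights mu -> \sum_i mu i *: a i = x0 ->
    \sum_i mu i * h i <= sup values.
  by move=> mu_ge0 muE; apply: (sup_upper_bound sup_values); exists mu.
pose a' (o : option I) : 'rV[R]_(N + 1) :=
  if o is Some i then row_mx (a i) (h i)%:M else row_mx 0 (-1)%:M.
have [|x a'x|lam lam_ge0 lamE] :=
  @farkas (option I) _ (None :: map Some (index_enum I)) a'
    (row_mx x0 (sup values)%:M).
- rewrite /= map_inj_uniq ?index_enum_uniq ?andbT; last by move=> i j [].
  by apply/mapP => -[].
- have mulE c r : (row_mx c r%:M *m x) 0 0 =
      (c *m usubmx x) 0 0 + r * dsubmx x 0 0.
    by rewrite -{1}[x]vsubmxK mul_row_col mul_scalar_mx !mxE.
  have t0 : 0 <= dsubmx x 0 0.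
    have := a'x None (mem_head _ _).
    by rewrite mulE mul0mx mxE add0r mulN1r oppr_le0.
  have feasible mu : nonneg_weights mu -> \sum_i mu i *: a i = x0 ->
      (x0 *m usubmx x) 0 0 + (\sum_i mu i * h i) * dsubmx x 0 0 <= 0.
    move=> mu_ge0 <-; rewrite mulmx_suml summxE mulr_suml -big_split /=.
    apply: sumr_le0 => i _; rewrite -scalemxAl mxE -mulrA -mulrDr.
    have := a'x (Some i); rewrite inE map_f ?mem_index_enum // mulE => le0.
    by apply: mulr_ge0_le0 (le0 isT).
  rewrite mulE; move: t0; rewrite le_eqVlt => /orP[/eqP t0|t_gt0].
    by have := feasible _ lam0_ge0 erefl; rewrite -t0 !mulr0.
  rewrite -lerBrDl sub0r -ler_pdivlMr //; apply: ge_sup;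
    first exact: sup_values.1.
  move=> _ [mu [mu_ge0 muE ->]]; rewrite ler_pdivlMr // -[leRHS]sub0r lerBrDl.
  exact: feasible.
have /eq_row_mx[x0E supE] : row_mx x0 (sup values)%:M =
    row_mx (\sum_i lam (Some i) *: a i)
      ((\sum_i lam (Some i) * h i - lam None)%:M : 'M[R]_1).
  rewrite lamE big_cons big_map /= scale_row_mx scaler0.
  under eq_bigr do rewrite scale_row_mx.
  rewrite sum_row_mx add_row_mx add0r; congr row_mx.
  apply/matrixP => i j; rewrite !ord1 !mxE summxE eqxx !mulr1n mulrN1 addrC.
  by congr (_ - _); apply: eq_bigr => k _; rewrite !mxE eqxx mulr1n.
exists (fun i => lam (Some i)); first by split=> // i.
move=> mu mu_ge0 muE; apply: le_trans (le_sup _ mu_ge0 muE) _.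
move/matrixP/(_ 0 0): supE; rewrite !mxE eqxx !mulr1n => ->.
by rewrite gerBl.
Qed.

(** An optimal [lam] has a certificate [y] with complementary slackness. If there
    were none, Farkas' lemma would give weights [mu] with the constraint value of
    [m0] copies of [lam] and height larger by [1]; then averaging [mu] and [lam]
    with total weight [1 + m0] beats [lam]. *)
Lemma lp_dual (lam : I -> R) : nonneg_weights lam ->
  (forall mu, nonneg_weights mu -> \sum_i mu i *: a i = \sum_i lam i *: a i ->
     \sum_i mu i * h i <= \sum_i lam i * h i) ->
  exists y : 'cV[R]_N, forall i, h i <= (a i *m y) 0 0 /\
    (0 < lam i -> h i = (a i *m y) 0 0).
Proof.
move=> lam_ge0 opt; set x0 := \sum_i lam i *: a i in opt *.
set H := \sum_i lam i * h i in opt *.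
pose a' (o : option I) : 'rV[R]_(N + 1) :=
  if o is Some i then row_mx (a i) (h i)%:M else row_mx (- x0) (- H)%:M.
have mulE (x : 'cV[R]_(N + 1)) c r : (row_mx c r%:M *m x) 0 0 =
    (c *m usubmx x) 0 0 + r * dsubmx x 0 0.
  by rewrite -{1}[x]vsubmxK mul_row_col mul_scalar_mx !mxE.
have [dual|] := pselect (forall x : 'cV[R]_(N + 1),
    (forall o, o \in None :: map Some (index_enum I) -> (a' o *m x) 0 0 <= 0) ->
    ((row_mx 0 1%:M : 'rV[R]_(N + 1)) *m x) 0 0 <= 0).
  have [|mu mu_ge0] := farkas _ dual.
    rewrite /= map_inj_uniq ?index_enum_uniq ?andbT; last by move=> i j [].
    by apply/mapP => -[].
  rewrite big_cons big_map /= scale_row_mx.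
  under eq_bigr do rewrite scale_row_mx.
  rewrite sum_row_mx add_row_mx => /eq_row_mx[]; set m0 := mu None.
  rewrite scalerN addrC => /esym/eqP; rewrite subr_eq0 => /eqP muE.
  move/matrixP/(_ 0 0); rewrite !mxE summxE eqxx !mulr1n mulrN addrC => heightE.
  have {}heightE : \sum_i mu (Some i) * h i = 1 + m0 * H.
    by rewrite heightE subrK; apply: eq_bigr => k _; rewrite !mxE eqxx mulr1n.
  have m1_gt0 : 0 < 1 + m0 by rewrite ltr_pwDl // mu_ge0.
  pose nu i := (mu (Some i) + lam i) / (1 + m0).
  have nu_ge0 : nonneg_weights nu.
    by move=> i; rewrite divr_ge0 ?addr_ge0 // ?mu_ge0 ?lam_ge0 // ltW.
  have nuE : \sum_i nu i *: a i = x0.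
    under eq_bigr do rewrite /nu mulrC -scalerA scalerDl.
    rewrite -scaler_sumr big_split /= muE -/x0 -{2}[x0]scale1r -scalerDl.
    by rewrite scalerA [m0 + 1]addrC mulVf ?scale1r // gt_eqF.
  have := opt nu nu_ge0 nuE; rewrite leNgt => /negP[].
  under eq_bigr do rewrite /nu mulrAC mulrDl.
  rewrite -mulr_suml big_split /= heightE -/H ltr_pdivlMr //.
  by rewrite mulrDr mulr1 [H * m0]mulrC; lra.
move=> /existsNP[x /not_implyP[a'x /negP]]; rewrite -ltNge mulE mul0mx mxE.
rewrite add0r mul1r => t_gt0; set t := dsubmx x 0 0 in t_gt0 *.
pose y := - t^-1 *: usubmx x.
have yE c : (c *m y) 0 0 = - ((c *m usubmx x) 0 0 / t).
  by rewrite -scalemxAr mxE mulNr mulrC.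
have le i : h i <= (a i *m y) 0 0.
  have := a'x (Some i);
    rewrite inE map_f ?mem_index_enum // mulE -/t => /(_ isT).
  by rewrite yE -mulNr ler_pdivlMr //; lra.
have le0 : (x0 *m y) 0 0 <= H.
  have := a'x None (mem_head _ _); rewrite mulE -/t mulNmx mxE => le0.
  by rewrite yE -mulNr ler_pdivrMr //; lra.
have /eqP sum0 : \sum_i lam i * ((a i *m y) 0 0 - h i) == 0.
  rewrite eq_le sumr_ge0 ?andbT => [|i _]; last by rewrite mulr_ge0 // subr_ge0.
  under eq_bigr do rewrite mulrBr.
  rewrite sumrB -/H subr_le0; apply: le_trans le0.
  rewrite /x0 mulmx_suml summxE; apply: ler_sum => i _.
  by rewrite -scalemxAl [leRHS]mxE.
exists y => i; split=> // lami.
move/eqP: sum0; rewrite psumr_eq0 => [/allP/(_ i)|k _]; last first.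
  by rewrite mulr_ge0 // subr_ge0.
rewrite mem_index_enum mulf_eq0 gt_eqF //= subr_eq0 => /(_ isT)/eqP.
by move->.
Qed.

End Program.
End LinearProgramming.

(** * Convex hulls of finite families, their faces and regular subdivisions *)

Section ConvexCombinations.
Variables (R : realType) (I : finType).

Definition combinations N (a : I -> 'rV[R]_N) (A : set I) : set 'rV[R]_N :=
  [set x | exists lam : I -> R, [/\ forall i, 0 <= lam i,
     forall i, 0 < lam i -> A i, \sum_i lam i = 1 & x = \sum_i lam i *: a i]].

Lemma sum_delta (V : lmodType R) (a : I -> V) i0 :
  \sum_i (i == i0)%:R *: a i = a i0.
Proof.
rewrite (bigD1 i0) //= eqxx scale1r big1 ?addr0 // => i /negPf->.
by rewrite scale0r.
Qed.

Lemma sum_delta1 (i0 : I) : \sum_i (i == i0)%:R = 1 :> R.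
Proof.
by rewrite (bigD1 i0) //= eqxx big1 ?addr0 // => i /negPf->.
Qed.

Lemma combinations_convex N (a : I -> 'rV[R]_N) A :
  convex_set (combinations a A : set (convex_lmodType 'rV[R]_N)).
Proof.
move=> x y l /set_mem[lam [lam0 lamA lam1 ->]] /set_mem[mu [mu0 muA mu1 ->]].
have t0 : 0 <= l%:num by exact: ge0.
have t1 : 0 <= 1 - l%:num by rewrite subr_ge0; exact: le1.
apply/classical_sets.mem_set; set t := l%:num in t0 t1 *.
exists (fun i => t * lam i + (1 - t) * mu i); split.
- by move=> i; rewrite addr_ge0 // mulr_ge0.
- move=> i h; have [/lamA//|lami] := ltP 0 (lam i).
  have [/muA//|mui] := ltP 0 (mu i).
  by move: h; rewrite ltNge -[leRHS]addr0 lerD // mulr_ge0_le0.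
- by rewrite big_split /= -!mulr_sumr lam1 mu1 !mulr1 addrC subrK.
under [RHS]eq_bigr do rewrite scalerDl -!scalerA.
by rewrite big_split /= -!scaler_sumr.
Qed.

(** Induction on the number of positive weights: split off one point and rescale
    the others. *)
Lemma combinations_sub_convex N (a : I -> 'rV[R]_N) A
    (M : set (convex_lmodType 'rV[R]_N)) :
  convex_set M -> a @` A `<=` M -> combinations a A `<=` M.
Proof.
move=> cM aM x [lam [lam0 lamA lam1 ->]] {x}.
have [n] := ubnP #|[pred i | 0 < lam i]|.
elim: n lam lam0 lamA lam1 => // n IHn lam lam0 lamA lam1 szn.
have [i lami] : exists i, 0 < lam i.
  apply/existsP; apply: contraT => /existsPn none.
  have : \sum_i lam i <= 0 by apply: sumr_le0 => i _; rewrite leNgt.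
  by rewrite lam1 ler10.
have Mai : M (a i) by apply: aM; exists i => //; apply: lamA.
have sumE : lam i + \sum_(j | j != i) lam j = 1 by rewrite -lam1 [RHS](bigD1 i).
have [lami1|lamiN1] := eqVneq (lam i) 1.
  have rest0 : \sum_(j | j != i) lam j = 0 by lra.
  rewrite (bigD1 i) //= lami1 scale1r big1 ?addr0 // => j ji.
  move/eqP: rest0; rewrite psumr_eq0 // => /allP/(_ j (mem_index_enum _)).
  by rewrite ji => /eqP->; rewrite scale0r.
have rest_ge0 : 0 <= \sum_(j | j != i) lam j by apply: sumr_ge0.
have s_gt0 : 0 < 1 - lam i.
  by rewrite subr_gt0 lt_neqAle lamiN1; lra.
pose mu j := if j == i then 0 else lam j / (1 - lam i).
have Mmu : M (\sum_j mu j *: a j).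
  apply: IHn.
  - by move=> j; rewrite /mu; case: ifP => // _; rewrite divr_ge0 // ltW.
  - move=> j; rewrite /mu; case: ifP => [|_ h]; first by rewrite ltxx.
    by apply: lamA; move: h; rewrite pmulr_lgt0 ?invr_gt0.
  - rewrite (bigD1 i) //= {1}/mu eqxx add0r.
    rewrite (eq_bigr (fun j => lam j / (1 - lam i))) => [|j /negPf ji].
      by rewrite -mulr_suml -[X in X / _](addKr (lam i)) sumE addrC divff
        ?gt_eqF.
    by rewrite /mu ji.
  move: szn; rewrite ltnS; apply: leq_trans; apply: proper_card.
  apply/properP; split; last first.
    by exists i; rewrite !finset.inE //= /mu eqxx ltxx.
  apply/fintype.subsetP => j; rewrite !finset.inE /mu; case: ifP => [|_ h].
    by rewrite ltxx.
  by move: h; rewrite pmulr_lgt0 ?invr_gt0.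
have l1 : lam i <= 1 by lra.
have := cM _ _ (Itv01 (lam0 i) l1) (classical_sets.mem_set Mai)
  (classical_sets.mem_set Mmu).
move/set_mem; congr M.
change (lam i *: a i + (1 - lam i) *: (\sum_j mu j *: a j) =
  \sum_j lam j *: a j).
rewrite [RHS](bigD1 i) //=; congr (_ + _).
rewrite (bigD1 i) //= {1}/mu eqxx scale0r add0r scaler_sumr.
apply: eq_bigr => j /negPf ji; rewrite /mu ji scalerA mulrC divfK //.
by rewrite gt_eqF.
Qed.

Lemma convex_hullE N (a : I -> 'rV[R]_N) A :
  convex_hull (a @` A) = combinations a A.
Proof.
apply/seteqP; split.
  apply: smallest_sub; first exact: combinations_convex.
  move=> _ [i Ai <-]; exists (fun j => (j == i)%:R); split=> //.
  - by move=> j; case: eqP => [->|]; rewrite ?ltxx.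
  - exact: sum_delta1.
  - by rewrite sum_delta.
by move=> x xA M [cM aM]; apply: combinations_sub_convex xA.
Qed.

Lemma combination_dot N (a : I -> 'rV[R]_N) (lam : I -> R) (c : 'cV[R]_N) :
  ((\sum_i lam i *: a i) *m c) 0 0 = \sum_i lam i * (a i *m c) 0 0.
Proof.
by rewrite mulmx_suml summxE; apply: eq_bigr => i _;
  rewrite -scalemxAl [LHS]mxE.
Qed.

Lemma mem_combinations N (a : I -> 'rV[R]_N) (A : set I) i :
  A i -> combinations a A (a i).
Proof.
move=> Ai; exists (fun j => (j == i)%:R); split=> //.
- by move=> j; case: eqP => [->|]; rewrite ?ltxx.
- exact: sum_delta1.
- by rewrite sum_delta.
Qed.

(** A convex combination maximizes a linear functional exactly when all points of
    positive weight do. *)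
Lemma face_combinations N (a : I -> 'rV[R]_N) (A : set I) (c : 'cV[R]_N) :
  face (combinations a A) c = combinations a
    [set i | A i /\ forall j, A j -> (a j *m c) 0 0 <= (a i *m c) 0 0].
Proof.
apply/seteqP; split=> x.
  move=> [[lam [lam0 lamA lam1 xE]] xmax].
  exists lam; split=> // i lami; split=> [|j Aj]; first exact: lamA.
  apply: le_trans (xmax _ (mem_combinations a Aj)) _.
  pose m k := (a k *m c) 0 0; have xc : (x *m c) 0 0 = \sum_k lam k * m k.
    by rewrite xE combination_dot.
  have gap_ge0 k : 0 <= lam k * ((x *m c) 0 0 - m k).
    have := lam0 k; rewrite le_eqVlt => /orP[/eqP<-|/lamA Ak].
      by rewrite mul0r.
    by rewrite mulr_ge0 // subr_ge0; apply/xmax/mem_combinations.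
  have : \sum_k lam k * ((x *m c) 0 0 - m k) == 0.
    under eq_bigr do rewrite mulrBr.
    by rewrite sumrB -mulr_suml lam1 mul1r -xc subrr.
  rewrite psumr_eq0 // => /allP/(_ i (mem_index_enum _)) /=.
  by rewrite mulf_eq0 gt_eqF //= subr_eq0 => /eqP->.
move=> [lam [lam0 lamA lam1 xE]]; split.
  by exists lam; split=> // i /lamA[].
move=> y [mu [mu0 muA mu1 yE]].
have -> : (y *m c) 0 0 = \sum_i lam i * (y *m c) 0 0.
  by rewrite -mulr_suml lam1 mul1r.
rewrite xE combination_dot; apply: ler_sum => i _.
have := lam0 i; rewrite le_eqVlt => /orP[/eqP<-|/lamA[_ maxi]].
  by rewrite !mul0r.
apply: ler_wpM2l => //; rewrite yE combination_dot.
rewrite -[leRHS]mul1r -mu1 mulr_suml; apply: ler_sum => j _.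
have := mu0 j; rewrite le_eqVlt => /orP[/eqP<-|/muA Aj].
  by rewrite !mul0r.
by rewrite ler_wpM2l // maxi.
Qed.

Definition upper_maximizers N (a : I -> 'rV[R]_N) (h : I -> R) (c : 'cV[R]_N)
    (t : R) : set I :=
  [set i | forall j, (a j *m c) 0 0 + t * h j <= (a i *m c) 0 0 + t * h i].

Lemma regular_subdivisionE N (a : I -> 'rV[R]_N) (h : I -> R) :
  regular_subdivision a h =
  [set s | exists c t, 0 < t /\ s = combinations a (upper_maximizers a h c t)].
Proof.
have dotE i (c : 'cV[R]_(N + 1)) : (row_mx (a i) (h i)%:M *m c) 0 0 =
    (a i *m usubmx c) 0 0 + dsubmx c 0 0 * h i.
  by rewrite -{1}[c]vsubmxK mul_row_col mul_scalar_mx !mxE [h i * _]mulrC.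
have cellE (c : 'cV[R]_(N + 1)) :
    lsubmx @` face (convex_hull (range (fun i => row_mx (a i) (h i)%:M))) c =
    combinations a (upper_maximizers a h (usubmx c) (dsubmx c 0 0)).
  rewrite convex_hullE face_combinations; apply/seteqP; split=> x.
    move=> [_ [lam [lam0 lamA lam1 ->]] <-]; exists lam; split=> //.
      by move=> i /lamA[_ maxi] j; rewrite -!dotE; apply: maxi.
    under eq_bigr do rewrite scale_row_mx.
    by rewrite sum_row_mx row_mxKl.
  move=> [lam [lam0 lamA lam1 ->]].
  exists (\sum_i lam i *: row_mx (a i) (h i)%:M).
    exists lam; split=> // i /lamA maxi; split=> // j _.
    by rewrite !dotE; apply: maxi.
  under eq_bigr do rewrite scale_row_mx.
  by rewrite sum_row_mx row_mxKl.
apply/seteqP; split=> s /=.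
  by move=> [c c0 <-]; exists (usubmx c), (dsubmx c 0 0); rewrite cellE.
move=> [c [t [t0 ->]]]; exists (col_mx c t%:M).
  by rewrite /= col_mxKd mxE eqxx.
by rewrite cellE col_mxKu col_mxKd mxE eqxx.
Qed.

End ConvexCombinations.

(** * From the exchange property to admissibility *)

Section Admissibility.
Variables (R : realType) (G : flow_graph) (F : framing G) (h : route G -> R).
Implicit Types (P Q S T B : route G) (C : {set route G}).

Hypothesis exchange : forall P Q, ~~ coherent F P Q ->
  exists T B, same_edges P Q T B /\ h P + h Q < h T + h B.

(** The leading coordinate [1] makes linear functionals of this vector affine
    functions of the indicator, and makes the total weight of a combination part
    of its value. *)
Definition homogenized P : 'rV[R]_(1 + num_edges G) :=
  row_mx 1%:M (indicator R P).

Lemma indicator_same_edges P Q T B : same_edges P Q T B ->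
  indicator R P + indicator R Q = indicator R T + indicator R B.
Proof.
by move=> PQTB; apply/rowP => e; rewrite !mxE -!natrD PQTB.
Qed.

Lemma homogenized_same_edges P Q T B : same_edges P Q T B ->
  homogenized P + homogenized Q = homogenized T + homogenized B.
Proof. by move=> /indicator_same_edges PQTB; rewrite !add_row_mx PQTB. Qed.

Lemma homogenized_dot P (y : 'cV[R]_(1 + num_edges G)) :
  (homogenized P *m y) 0 0 = usubmx y 0 0 + (indicator R P *m dsubmx y) 0 0.
Proof. by rewrite -{1}[y]vsubmxK mul_row_col mul1mx mxE. Qed.

Lemma homogenized_sum (lam mu : route G -> R) :
  \sum_P lam P *: homogenized P = \sum_P mu P *: homogenized P ->
  \sum_P lam P = \sum_P mu P /\
  (forall e, \sum_(P : route G | e \in (P : seq (edge G))) lam P =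
             \sum_(P : route G | e \in (P : seq (edge G))) mu P).
Proof.
have sumE nu : \sum_P nu P *: homogenized P = row_mx (\sum_P nu P)%:M
    (\row_e \sum_(P : route G | e \in (P : seq (edge G))) nu P).
  under eq_bigr do rewrite /homogenized scale_row_mx.
  rewrite sum_row_mx; congr row_mx.
    apply/matrixP => i j; rewrite !ord1 summxE mxE eqxx mulr1n.
    by apply: eq_bigr => P _; rewrite !mxE eqxx mulr1.
  apply/rowP => e; rewrite summxE mxE [RHS]big_mkcond /=; apply: eq_bigr => P _.
  by rewrite !mxE; case: ifP => _; rewrite ?mulr1 ?mulr0.
rewrite !sumE => /eq_row_mx[/matrixP/(_ 0 0) + /rowP edges];
  rewrite !mxE !mulr1n.
by move=> ->; split=> // e; have := edges e; rewrite !mxE.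
Qed.

Lemma coherent_refl P : coherent F P P.
Proof.
apply/forallP => v; apply/negP => /incoherent_atP[_ [w [w' [_ cr]]]].
have [e [f [e' [f' [[eP _ _ _ /andP[eP' _]] _]]]]] := crossing_ends cr.
by rewrite eP in eP'.
Qed.

(** If two incoherent routes had positive weight, moving a little weight from them
    to the pair provided by [exchange] would raise the height without changing
    the flow. *)
Lemma optimal_coherently_supported (lam : route G -> R) : nonneg_weights lam ->
  (forall mu, nonneg_weights mu ->
     \sum_P mu P *: homogenized P = \sum_P lam P *: homogenized P ->
     \sum_P mu P * h P <= \sum_P lam P * h P) ->
  coherently_supported F lam.
Proof.
move=> lam0 opt P Q lamP lamQ; apply/negPn/negP => /exchange[T [B [PQTB hPQ]]].
(* Half of the minimum leaves room for the case that a route occurs twice among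
   those that lose weight. *)
pose eps := Num.min (lam P) (lam Q) / 2.
have eps_gt0 : 0 < eps by rewrite divr_gt0 // lt_min lamP lamQ.
have epsP : eps + eps <= lam P by rewrite -splitr ge_min lexx.
have epsQ : eps + eps <= lam Q by rewrite -splitr ge_min lexx orbT.
pose d S S' : R := (S' == S)%:R.
pose mu S := lam S + eps * (d T S + d B S - d P S - d Q S).
have d01 S S' : 0 <= d S S' <= 1 by rewrite ler0n lern1 leq_b1.
have mu_ge0 : nonneg_weights mu.
  move=> S; rewrite /mu; have [SP|SP] := eqVneq S P.
    by have := d01 T S; have := d01 B S; have := d01 P S; have := d01 Q S;
      rewrite SP; nra.
  have [SQ|SQ] := eqVneq S Q.
    by have := d01 T S; have := d01 B S; have := d01 P S; have := d01 Q S;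
      rewrite SQ; nra.
  rewrite /d (negPf SP) (negPf SQ) !subr0 addr_ge0 ?lam0 //.
  by rewrite mulr_ge0 ?(ltW eps_gt0) // addr_ge0 // ler0n.
have sumE (V : lmodType R) (f : route G -> V) :
    \sum_S mu S *: f S = \sum_S lam S *: f S + eps *: (f T + f B - f P - f Q).
  rewrite /mu; under eq_bigr do rewrite scalerDl -scalerA !scalerBl scalerDl.
  rewrite big_split /= -scaler_sumr; congr (_ + eps *: _).
  by rewrite !sumrB big_split /= !sum_delta.
have muE : \sum_S mu S *: homogenized S = \sum_S lam S *: homogenized S.
  rewrite sumE -(homogenized_same_edges PQTB).
  by rewrite [_ + homogenized Q]addrC addrK subrr scaler0 addr0.
have := opt mu mu_ge0 muE; rewrite (sumE R^o h) leNgt => /negP[].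
by rewrite ltrDl mulr_gt0 //; lra.
Qed.

(** Some affine function [y] lies above [h] and touches it exactly on [C]. Among all
    weights with the same flow as the indicator of [C], an optimal one is coherently
    supported, so by uniqueness it is that indicator. The optimal dual solution [y]
    touches [h] on [C], and the routes where it touches [h] form a clique by
    [exchange]; maximality gives the rest. *)
Lemma maximal_clique_supported C : maximal_clique F C ->
  exists y : 'cV[R]_(1 + num_edges G), forall P,
    h P <= (homogenized P *m y) 0 0 /\
    (P \in C <-> h P = (homogenized P *m y) 0 0).
Proof.
move=> /finset.maxsetP[cliqueC maxC].
pose lam0 P : R := (P \in C)%:R.
have lam0_ge0 : nonneg_weights lam0 by move=> P; apply: ler0n.
have coh0 : coherently_supported F lam0.
  move=> P Q; rewrite !ltr0n !lt0b => PC QC.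
  by have /'forall_implyP/(_ P PC)/'forall_implyP/(_ Q QC) := cliqueC.
have [|lam [lam_ge0 lamE] opt] := lp_attained (a := homogenized) (h := h)
    (M := \sum_P (\sum_Q lam0 Q) * `|h P|) lam0_ge0.
  move=> mu mu_ge0 /homogenized_sum[<- _]; apply: ler_sum => P _.
  apply: (le_trans (ler_norm _)); rewrite normrM ger0_norm // ler_wpM2r //.
  by rewrite (bigD1 P) //= lerDl sumr_ge0.
have {}opt : forall mu, nonneg_weights mu ->
    \sum_P mu P *: homogenized P = \sum_P lam P *: homogenized P ->
    \sum_P mu P * h P <= \sum_P lam P * h P.
  by move=> mu mu_ge0; rewrite lamE; apply: opt.
have coh := optimal_coherently_supported lam_ge0 opt.
have [tot edges] := homogenized_sum lamE.
have lam_lam0 := coherent_decomposition_unique lam_ge0 lam0_ge0 coh coh0 tot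
  edges.
have [y yP] := lp_dual lam_ge0 opt; exists y => P.
split; first by case: (yP P).
split=> [PC|hP]; first by apply: (yP P).2; rewrite lam_lam0 /lam0 PC ltr01.
pose E := [set Q | h Q == (homogenized Q *m y) 0 0]%SET.
suff <- : E = C by rewrite finset.inE hP.
apply: maxC.
  apply/'forall_implyP => Q1; rewrite finset.inE => /eqP h1.
  apply/'forall_implyP => Q2; rewrite finset.inE => /eqP h2.
  apply/negPn/negP => /exchange[T [B [same]]]; rewrite ltNge => /negP[].
  rewrite h1 h2; apply: (@le_trans _ _ ((homogenized T *m y) 0 0 +
    (homogenized B *m y) 0 0)).
    by apply: lerD; [case: (yP T)|case: (yP B)].
  have /(congr1 (fun v : 'rV[R]_(1 + num_edges G) => (v *m y) 0 0)) :=
    homogenized_same_edges same.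
  by rewrite !mulmxDl mxE [RHS]mxE => ->.
apply/fintype.subsetP => Q QC; rewrite finset.inE; apply/eqP.
by apply: (yP Q).2; rewrite lam_lam0 /lam0 QC ltr01.
Qed.

Lemma maximal_clique_neq0 C P : maximal_clique F C -> exists Q, Q \in C.
Proof.
move=> /finset.maxsetP[_ maxC]; have [C0|[Q QC]] := set_0Vmem C;
  last by exists Q.
exists P; rewrite -(maxC [set P]%SET) ?set11 ?C0 ?finset.sub0set //.
apply/'forall_implyP => Q1; rewrite finset.in_set1 => /eqP->.
apply/'forall_implyP => Q2; rewrite finset.in_set1 => /eqP->.
exact: coherent_refl.
Qed.

Lemma small_multiplier (K : finType) (b g : K -> R) :
  exists2 eps : R, 0 < eps & forall k, 0 < g k -> eps * b k < g k.
Proof.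
pose M := 1 + \sum_k `|b k| / `|g k|.
have M_gt0 : 0 < M by rewrite ltr_pwDl // sumr_ge0 // => k _; rewrite divr_ge0.
exists M^-1; first by rewrite invr_gt0.
move=> k gk; rewrite mulrC ltr_pdivrMr //.
apply: le_lt_trans (ler_norm _) _; rewrite -ltr_pdivrMl // mulrC.
rewrite /M (bigD1 k) //= (gtr0_norm gk).
have : 0 <= \sum_(i | i != k) `|b i| / `|g i| by rewrite sumr_ge0 // => i _;
  rewrite divr_ge0.
lra.
Qed.

Lemma upper_maximizers_clique c (t : R) : 0 < t ->
  clique F [set P | `[< upper_maximizers (@indicator R G) h c t P >]]%SET.
Proof.
move=> t_gt0.
apply/'forall_implyP => P; rewrite finset.inE => /asboolW maxP.
apply/'forall_implyP => Q; rewrite finset.inE => /asboolW maxQ.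
apply/negPn/negP => /exchange[T [B [same hPQ]]].
have := lerD (maxP T) (maxQ B).
have := congr1 (fun v : 'rV[R]_(num_edges G) =>
  (v *m c) 0 0) (indicator_same_edges same).
rewrite /= !mulmxDl mxE [X in _ = X]mxE => sameE.
have : t * (h P + h Q) < t * (h T + h B) by rewrite ltr_pM2l.
lra.
Qed.

(** Over a maximal clique [C], [h] coincides with an affine function. Hence the upper
    cell for [(c, t)], which is spanned by a clique and so lies over some [C], is
    the face of the simplex of [C] in a modified direction. Conversely, tilting the
    supporting function of [C] by a small multiple of [c] cuts out the face in
    direction [c]. *)
Theorem exchange_admissible : admissible_height F h.
Proof.
rewrite /admissible_height regular_subdivisionE; apply/seteqP; split=> s /=.
  move=> [c [t [t_gt0 ->]]].
  have [C maxC MC] := finset.maxset_exists (upper_maximizers_clique c t_gt0).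
  exists C => //; have [y yP] := maximal_clique_supported maxC.
  exists (c + t *: dsubmx y); rewrite convex_hullE face_combinations.
  pose phi P := (indicator R P *m c) 0 0 + t * h P.
  have phiE P : P \in C -> (indicator R P *m (c + t *: dsubmx y)) 0 0 =
      phi P - t * usubmx y 0 0.
    move=> /(yP P).2 hP; rewrite /phi hP homogenized_dot.
    by rewrite mulmxDr -scalemxAr mxE [X in _ + X]mxE; lra.
  congr combinations; apply/seteqP; split=> P /=.
    move=> maxP.
    have PC : P \in C by apply: (fintype.subsetP MC); rewrite finset.inE;
      apply/asboolT.
    split=> // Q QC; rewrite !phiE // lerD2r; exact: maxP.
  move=> [PC maxP] Q.
  have [S _ maxS] := @arg_maxP _ _ _ P xpredT phi isT.
  have SC : S \in C.
    apply: (fintype.subsetP MC); rewrite finset.inE; apply/asboolT => S'.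
    exact: maxS.
  apply: le_trans (maxS Q isT) _.
  by have := maxP S SC; rewrite !phiE // lerD2r.
move=> [C maxC [c ->]]; rewrite convex_hullE face_combinations.
have [y yP] := maximal_clique_supported maxC.
pose gap P := (homogenized P *m y) 0 0 - h P.
pose val P := (indicator R P *m c) 0 0.
have [eps eps_gt0 epsP] := small_multiplier
  (fun k : route G * route G => val k.1 - val k.2) (fun k => gap k.1).
have gap0 P : P \in C -> gap P = 0 by move/(yP P).2; rewrite /gap => ->;
  rewrite subrr.
have gap_gt0 P : P \notin C -> 0 < gap P.
  move=> PC; rewrite subr_gt0 lt_neqAle (yP P).1 andbT.
  by apply: contra PC => /eqP/(yP P).2.
exists (eps *: c - dsubmx y), 1; split=> //.
have phiE P : (indicator R P *m (eps *: c - dsubmx y)) 0 0 + 1 * h P =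
    eps * val P - gap P + usubmx y 0 0.
  rewrite /gap homogenized_dot mulmxBr -scalemxAr /val.
  by move: (indicator R P *m _) (indicator R P *m _) => A B; rewrite !mxE; lra.
congr combinations; apply/seteqP; split=> P /=.
  move=> [PC maxP] Q; rewrite !phiE lerD2r (gap0 P) // subr0.
  have [QC|QC] := boolP (Q \in C).
    by rewrite (gap0 Q) // subr0 ler_pM2l //; apply: maxP.
  have := epsP (Q, P) (gap_gt0 Q QC); rewrite /= mulrBr; lra.
move=> maxP; have PC : P \in C.
  apply: contraT => PC; have [Q QC] := maximal_clique_neq0 P maxC.
  have := epsP (P, Q) (gap_gt0 P PC); have := maxP Q.
  rewrite !phiE (gap0 Q) //= mulrBr; lra.
split=> // Q QC; have := maxP Q; rewrite !phiE (gap0 P) // (gap0 Q) // !subr0.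
by rewrite lerD2r ler_pM2l.
Qed.

End Admissibility.


(** * Geometric heights are admissible *)

Theorem proposition7p7 (R : realType) (G : flow_graph) (F : framing G)
    (D : drawing R G) :
  ABBE F D ->
  admissible_height F (fun P : route G => (num_routes_below D P)%:R%R : R).
Proof.
move=> abbe; apply: exchange_admissible =>
  P Q /(ABBE_exchange abbe)[T [B [same lt]]].
by exists T, B; split=> //; rewrite -!natrD ltr_nat.
Qed.
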